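(* Let $\Phi(\lambda)$ be a frame of a Lax pair $(\mathcal U(\lambda),\mathcal V(\lambda))$ on $\mathbb{Z}^2$ with coefficients $a,b,u,v,\alpha,\beta$, let $\lambda_1=e^{i\gamma_1}$, $\lambda_2=e^{i\gamma_2}$ be in the unit circle, and let $$F=\Phi(\lambda_1)^{-1}\mathbf M\,\Phi(\lambda_2),\qquad N=-\Phi(\lambda_1)^{-1}\mathbf k\,\mathbf M\,\Phi(\lambda_2),\qquad \mathbf M=\exp\!\Big(\frac{\gamma_1-\gamma_2}{2}\mathbf k\Big).$$ The pair $(F,N)$ is a discrete isothermic constant mean curvature surface in $\mathbb{S}^3$ if, and only if, $\lambda_2=\pm\lambda_1^{-1}$ ($\gamma_1+\gamma_2\equiv0 \bmod \pi$). Its mean curvature is equal to $$H=\frac{\operatorname{Re}\lambda_1^2}{\operatorname{Im}\lambda_1^2}=\cot(2\gamma_1)=\cot(\gamma_1-\gamma_2).$$ Its Christoffel dual is $F^*=F+\frac1HN$ if $H\ne0$, and $F^*=N$ if $H=0$. On any quad the discrete conformal metric $s$ of $F$ is given by $$ss_1=-u^2\sqrt{\tfrac{H^2}{1+H^2}}\ \text{ and }\ ss_2=v^2\sqrt{\tfrac{H^2}{1+H^2}}\quad\text{if }H\neq0,\qquad ss_1=-u^2\ \text{ and }\ ss_2=v^2\quad\text{if }H=0,$$ and the cross ratio of $(F,F_1,F_{12},F_2)$ is equal to $-\beta^2/\alpha^2$ evaluated at $\lambda_1$. The edge lengths satisfy (with $\alpha,\beta$ evaluated at $\lambda_1$), when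 $H\ne0$, $$\|F_1-F\|^2=\frac{4u^2\sin^2(2\gamma_1)}{\alpha^2}=\frac{4|ss_1|}{\alpha^2H\sqrt{1+H^2}}=\frac{4|ss_1|}{\Big(|a|^2+u^2+u^{-2}+\sqrt{\frac{H^2}{1+H^2}}\Big)H\sqrt{1+H^2}},$$ $$\|F_2-F\|^2=\frac{4v^2\sin^2(2\gamma_1)}{\beta^2}=\frac{4|ss_2|}{\beta^2H\sqrt{1+H^2}}=\frac{4|ss_2|}{\Big(|b|^2+v^2+v^{-2}-\sqrt{\frac{H^2}{1+H^2}}\Big)H\sqrt{1+H^2}},$$ and for minimal nets, $$\|F_1-F\|^2=\frac{4u^2}{\alpha^2}=-\frac{4ss_1}{|a|^2-ss_1-s^{-1}s_1^{-1}},\qquad \|F_2-F\|^2=\frac{4v^2}{\beta^2}=\frac{4ss_2}{|b|^2+ss_2+s^{-1}s_2^{-1}} .$$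
   Context: Notation. For a function $f$ on $\mathbb{Z}^2$, $f,f_1,f_2,f_{12}$ denote its values at $(m,n),(m+1,n),(m,n+1),(m+1,n+1)$; faces (quads) are the quadruples $(f,f_1,f_{12},f_2)$. Quaternions are represented by complex $2\times2$ matrices with $$\mathbf i=\begin{pmatrix}0&-i\\-i&0\end{pmatrix},\ \mathbf j=\begin{pmatrix}0&-1\\1&0\end{pmatrix},\ \mathbf k=\begin{pmatrix}-i&0\\0&i\end{pmatrix},\ \mathbf 1=\begin{pmatrix}1&0\\0&1\end{pmatrix};$$ $(X_1,X_2,X_3,X_4)\in\mathbb{R}^4$ corresponds to $X_1\mathbf i+X_2\mathbf j+X_3\mathbf k+X_4\mathbf 1$, and $\mathbb{S}^3$ to unit quaternions, i.e. $SU(2)$. The cross ratio of $(F,F_1,F_{12},F_2)$ is the quaternion $(F-F_1)(F_1-F_{12})^{-1}(F_{12}-F_2)(F_2-F)^{-1}$; a real value $c$ means $c\,\mathbf 1$. Lax pair. To every edge $((m,n),(m+1,n))$, resp. $((m,n),(m,n+1))$, is attached a matrix $$\mathcal U(\lambda)=\frac1{\alpha(\lambda)}\begin{pmatrix}a&-\lambda u-\lambda^{-1}u^{-1}\\ \lambda u^{-1}+\lambda^{-1}u&\bar a\end{pmatrix},\ \text{ resp. }\ \mathcal V(\lambda)=\frac1{\beta(\lambda)}\begin{pmatrix}b&-i\lambda v+i\lambda^{-1}v^{-1}\\ i\lambda v^{-1}-i\lambda^{-1}v&\bar b\end{pmatrix},\quad|\lambda|=1,$$ with $a,b$ complex and $u,v>0$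 independent of $\lambda$, and $\alpha(\lambda),\beta(\lambda)$ real such that the determinants equal $1$, i.e. $\alpha(\lambda)^2=|a|^2+\lambda^2+\lambda^{-2}+u^2+u^{-2}$, $\beta(\lambda)^2=|b|^2-\lambda^2-\lambda^{-2}+v^2+v^{-2}$. The functions $\alpha$ and $\beta$ coincide on opposite edges of each face, and on each face $\mathcal V'(\lambda)\,\mathcal U(\lambda)=\mathcal U'(\lambda)\,\mathcal V(\lambda)$, where $\mathcal U,\mathcal V$ belong to the edges from vertex $0$ to $1$ and from $0$ to $2$ and $\mathcal U',\mathcal V'$ to the opposite edges. A frame is a map $\Phi$ from $\mathbb{Z}^2$ into the loops $\lambda\mapsto\Phi(\lambda)\in SU(2)$, $|\lambda|=1$, with $\Phi(-\lambda)=\sigma_3\Phi(\lambda)\sigma_3$, $\sigma_3=\mathrm{diag}(1,-1)$, such that $\Phi_1=\mathcal U\Phi$, $\Phi_2=\mathcal V\Phi$. In the claim, $u,a,\alpha$ refer to the edge from $0$ to $1$ and $v,b,\beta$ to the edge from $0$ to $2$. CMC nets in $\mathbb{S}^3$. A pair $(F,N)$ of edge-parallel maps $\mathbb{Z}^2\to\mathbb{S}^3$ with planar faces and $F\perp N$ at each vertex ($N$ being the Gauss map of $F$) has constant mean curvature $H$ (is minimal if $H=0$) if $H_f=-\mathcal A(F(f),N(f))/\mathcal A(F(f))$ equals $H$ on every face $f$; here $\mathcal A$ is the area of planar quads (a quadratic form) and $\mathcal A(f,f')=\frac14(\mathcal A(f+f')-\mathcal A(f-f'))$ is the mixed area of edge-parallel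 quads. A Christoffel dual of $F$ is a net $F^*$ edge-parallel to $F$ with $\mathcal A(F,F^* )=0$ on every face. $F$ is discrete isothermic if its faces are circular and it possesses a Christoffel dual. A discrete conformal metric of $F$ is a nowhere vanishing real function $s$ on $\mathbb{Z}^2$ with $F^*_i-F^*=\frac1{s\,s_i}(F_i-F)$, $i=1,2$; it is defined up to black-white rescaling (multiplication by one constant on the vertices with $m+n$ even and by another on those with $m+n$ odd).
   Formalization: ''Only if'' is claimed when a, b are not all zero (else it fails); Im λ₁² ≠ 0 is required (else F is constant, H undefined); edge-length denominators use |H|, and their third forms have ±2·sgn(Re λ₁²)·√(H²/(1+H²)) in place of ±√(H²/(1+H²)). *)

(* Defs.v *)
From HB Require Import structures.
From mathcomp Require Import all_boot all_order all_algebra.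
From mathcomp Require Import ring spectral complex.
From mathcomp Require Import all_classical all_reals all_analysis.

Set Implicit Arguments.
Unset Strict Implicit.
Unset Printing Implicit Defensive.

Import Order.TTheory GRing.Theory Num.Theory.
Import numFieldNormedType.Exports.

Local Open Scope classical_set_scope.
Local Open Scope ring_scope.
Local Open Scope complex_scope.

Section Quaternions.
Variable R : realType.

Definition mx2 (x y z w : R[i]) : 'M[R[i]]_2 :=
  \matrix_(i, j) if i == 0 then (if j == 0 then x else y)
                 else (if j == 0 then z else w).

Definition qi : 'M[R[i]]_2 := mx2 0 (- (0 +i* 1)) (- (0 +i* 1)) 0.
Definition qj : 'M[R[i]]_2 := mx2 0 (-1) 1 0.
Definition qk : 'M[R[i]]_2 := mx2 (- (0 +i* 1)) 0 0 (0 +i* 1).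
Definition sigma3 : 'M[R[i]]_2 := mx2 1 0 0 (-1).

Definition quat (x : 'rV[R]_4) : 'M[R[i]]_2 :=
  (x 0 0)%:C *: qi + (x 0 1)%:C *: qj + (x 0 2)%:C *: qk + (x 0 3)%:C *: 1%:M.

(* The inverse of quat on quaternions, read off the second row of
   quat x = [[x3 - i x2, - x1 - i x0], [x1 - i x0, x3 + i x2]];
   see quatK and SU2_coordsK below. *)
Definition coords (X : 'M[R[i]]_2) : 'rV[R]_4 :=
  \row_(j < 4) nth 0 [:: - complex.Im (X 1 0); complex.Re (X 1 0);
                         complex.Im (X 1 1); complex.Re (X 1 1)] j.

Definition SU2 (X : 'M[R[i]]_2) : Prop := X \is unitarymx /\ \det X = 1.

Lemma mx2E (X : 'M[R[i]]_2) : X = mx2 (X 0 0) (X 0 1) (X 1 0) (X 1 1).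
Proof.
apply/matrixP => i j; rewrite mxE.
have h : forall k : 'I_2, k = if k == 0 then 0 else 1.
  by move=> k; apply/val_inj; case: k => [[|[|k]] hk].
by rewrite {1}(h i) {1}(h j); do 2!case: ifP => _.
Qed.

Lemma quatE x : quat x =
  mx2 (x 0 3 -i* x 0 2) (- x 0 1 -i* x 0 0)
      (x 0 1 -i* x 0 0) (x 0 3 +i* x 0 2).
Proof.
rewrite [LHS]mx2E; congr mx2; rewrite !mxE /=; apply/eqP; rewrite eq_complex /=;
  by rewrite !(mulr0, mulr1, mul0r, mulrN, mulNr, oppr0, addr0, add0r, subr0,
               opprK, eqxx).
Qed.

Lemma quatK : cancel quat coords.
Proof.
move=> x; apply/rowP => j; rewrite mxE quatE !mxE /=.
by case: j => [[|[|[|[|j]]]] hj] //=; rewrite ?opprK; congr (x _ _); apply/val_inj.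
Qed.

Lemma det2_mx (X : 'M[R[i]]_2) : \det X = X 0 0 * X 1 1 - X 0 1 * X 1 0.
Proof.
have l0 : lift ord0 ord0 = 1 :> 'I_2 by apply/val_inj.
have l1 : lift 1 ord0 = 0 :> 'I_2 by apply/val_inj.
rewrite (expand_det_row _ 0) big_ord_recl big_ord1 /cofactor !det_mx11 !mxE.
by rewrite !l0 !l1 /= expr0 mul1r expr1 mulN1r mulrN.
Qed.

Lemma SU2_coordsK X : SU2 X -> quat (coords X) = X.
Proof.
case=> /unitarymxP XXt dX.
have l0 : lift ord0 ord0 = 1 :> 'I_2 by apply/val_inj.
have e01 : X 0 1 * (X 1 1)^* = - (X 0 0 * (X 1 0)^*).
  apply/eqP; rewrite -addr_eq0 addrC; apply/eqP.
  have /matrixP/(_ 0 1) := XXt.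
  by rewrite !mxE big_ord_recl big_ord1 !mxE !l0.
have e11 : X 1 0 * (X 1 0)^* + X 1 1 * (X 1 1)^* = 1.
  have /matrixP/(_ 1 1) := XXt.
  by rewrite !mxE big_ord_recl big_ord1 !mxE !l0.
have d : X 0 0 * X 1 1 - X 0 1 * X 1 0 = 1 by rewrite -dX det2_mx.
have E00 : X 0 0 = (X 1 1)^*.
  rewrite -[LHS]mulr1 -[RHS]mulr1 -{1}e11 -d.
  apply/eqP; rewrite -subr_eq0; apply/eqP.
  transitivity (X 1 0 * (X 0 0 * (X 1 0)^* + X 0 1 * (X 1 1)^*)); first by ring.
  by rewrite e01 subrr mulr0.
have E01 : X 0 1 = - (X 1 0)^*.
  rewrite -[LHS]mulr1 -[RHS]mulr1 -{1}e11 -d.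
  apply/eqP; rewrite -subr_eq0; apply/eqP.
  transitivity (X 1 1 * (X 0 0 * (X 1 0)^* + X 0 1 * (X 1 1)^*)); first by ring.
  by rewrite e01 subrr mulr0.
rewrite quatE [RHS]mx2E E00 E01 !mxE /=.
by congr mx2; case: (X 1 _) => p q; apply/eqP; rewrite eq_complex /= ?opprK !eqxx.
Qed.

Definition expi (t : R) : R[i] := cos t +i* sin t.

(* The exponential series, summed entrywise. *)
Definition expmx (X : 'M[R[i]]_2) : 'M[R[i]]_2 :=
  let term n : 'M[R[i]]_2 := (n`!%:R)^-1 *: X ^+ n in
  \matrix_(i, j)
    (limn (series (fun n => complex.Re (term n i j)))
     +i* limn (series (fun n => complex.Im (term n i j)))).

Definition cot (x : R) : R := cos x / sin x.

End Quaternions.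

Section LaxPair.
Variable R : realType.
Implicit Types (a b : int -> int -> R[i]) (u v : int -> int -> R).
Implicit Types (alpha beta : int -> int -> R[i] -> R).
Implicit Types (Phi : int -> int -> R[i] -> 'M[R[i]]_2).

Definition Umx (a : R[i]) (u : R) (alpha : R[i] -> R) (l : R[i]) :
    'M[R[i]]_2 :=
  ((alpha l)^-1)%:C *:
    mx2 a (- (l * u%:C) - l^-1 * (u^-1)%:C)
        (l * (u^-1)%:C + l^-1 * u%:C) a^*.

Definition Vmx (b : R[i]) (v : R) (beta : R[i] -> R) (l : R[i]) :
    'M[R[i]]_2 :=
  let ii : R[i] := 0 +i* 1 in
  ((beta l)^-1)%:C *:
    mx2 b (- (ii * l * v%:C) + ii * l^-1 * (v^-1)%:C)
        (ii * l * (v^-1)%:C - ii * l^-1 * v%:C) b^*.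

(* Index (m, n) stands for the edge from (m, n) to (m + 1, n) for a, u, alpha,
   and for the edge from (m, n) to (m, n + 1) for b, v, beta. *)
Record lax_pair a b u v alpha beta : Prop := LaxPair {
  lax_u_gt0 : forall m n, 0 < u m n;
  lax_v_gt0 : forall m n, 0 < v m n;
  lax_detU : forall m n l, `|l| = 1 ->
    \det (Umx (a m n) (u m n) (alpha m n) l) = 1;
  lax_detV : forall m n l, `|l| = 1 ->
    \det (Vmx (b m n) (v m n) (beta m n) l) = 1;
  lax_alpha : forall m n l, `|l| = 1 -> alpha m (n + 1) l = alpha m n l;
  lax_beta : forall m n l, `|l| = 1 -> beta (m + 1) n l = beta m n l;
  lax_compat : forall m n l, `|l| = 1 ->
    Vmx (b (m + 1) n) (v (m + 1) n) (beta (m + 1) n) l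
      *m Umx (a m n) (u m n) (alpha m n) l
    = Umx (a m (n + 1)) (u m (n + 1)) (alpha m (n + 1)) l
      *m Vmx (b m n) (v m n) (beta m n) l }.

(* A loop is a continuous map on the unit circle, parametrized here by the
   angle. Without continuity the signs of alpha l and alpha l^-1, which the
   determinants leave free, would be unrelated. *)
Record frame a b u v alpha beta Phi : Prop := Frame {
  frame_SU2 : forall m n l, `|l| = 1 -> SU2 (Phi m n l);
  frame_loop : forall m n i j,
    continuous (fun t : R => complex.Re (Phi m n (expi t) i j)) /\
    continuous (fun t : R => complex.Im (Phi m n (expi t) i j));
  frame_twisted : forall m n l, `|l| = 1 ->
    Phi m n (- l) = sigma3 R *m Phi m n l *m sigma3 R;
  frame_U : forall m n l, `|l| = 1 ->
    Phi (m + 1) n l = Umx (a m n) (u m n) (alpha m n) l *m Phi m n l;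
  frame_V : forall m n l, `|l| = 1 ->
    Phi m (n + 1) l = Vmx (b m n) (v m n) (beta m n) l *m Phi m n l }.

Definition Mgauge (g1 g2 : R) : 'M[R[i]]_2 :=
  expmx (((g1 - g2) / 2)%:C *: qk R).

Definition netF Phi (g1 g2 : R) (m n : int) : 'rV[R]_4 :=
  coords (invmx (Phi m n (expi g1)) *m Mgauge g1 g2 *m Phi m n (expi g2)).

Definition netN Phi (g1 g2 : R) (m n : int) : 'rV[R]_4 :=
  coords (- (invmx (Phi m n (expi g1)) *m qk R *m Mgauge g1 g2
             *m Phi m n (expi g2))).

End LaxPair.

Section Nets.
Variable R : realType.
Implicit Types (x y e : 'rV[R]_4) (F G N : int -> int -> 'rV[R]_4).
Implicit Types (s t : int -> int -> R) (m n : int).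

Definition dot x y : R := \sum_i x 0 i * y 0 i.
Definition sqnorm x : R := dot x x.

Definition parallel x y : Prop :=
  exists c : R, y = c *: x \/ x = c *: y.

Definition edge_parallel F G : Prop := forall m n,
  parallel (F (m + 1) n - F m n) (G (m + 1) n - G m n) /\
  parallel (F m (n + 1) - F m n) (G m (n + 1) - G m n).

Definition orthonormal e1 e2 : Prop :=
  [/\ sqnorm e1 = 1, sqnorm e2 = 1 & dot e1 e2 = 0].

Definition in_span e1 e2 x : Prop := exists p q : R, x = p *: e1 + q *: e2.

(* The face (m, n) of F lies in a translate of the plane spanned by e1, e2. *)
Definition face_in_plane e1 e2 F m n : Prop :=
  [/\ in_span e1 e2 (F (m + 1) n - F m n),
      in_span e1 e2 (F (m + 1) (n + 1) - F m n) &
      in_span e1 e2 (F m (n + 1) - F m n)].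

Definition planar_faces F : Prop := forall m n,
  exists e1 e2, orthonormal e1 e2 /\ face_in_plane e1 e2 F m n.

(* Signed area of a face parallel to the plane oriented by its orthonormal
   basis (e1, e2), by the shoelace formula. *)
Definition area e1 e2 F m n : R :=
  let w x y := dot x e1 * dot y e2 - dot x e2 * dot y e1 in
  2^-1 * (w (F m n) (F (m + 1) n) + w (F (m + 1) n) (F (m + 1) (n + 1))
          + w (F (m + 1) (n + 1)) (F m (n + 1)) + w (F m (n + 1)) (F m n)).

Definition mixed_area e1 e2 F G m n : R :=
  4^-1 * (area e1 e2 (fun k l => F k l + G k l) m n
          - area e1 e2 (fun k l => F k l - G k l) m n).

Definition circular_faces F : Prop := forall m n,
  exists (c e1 e2 : 'rV[R]_4) (r : R),
    [/\ 0 < r, orthonormal e1 e2 &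
        forall x, x \in [:: F m n; F (m + 1) n; F (m + 1) (n + 1); F m (n + 1)] ->
          in_span e1 e2 (x - c) /\ sqnorm (x - c) = r ^+ 2].

(* As the area of F does not vanish, the plane (e1, e2) is determined up to
   orientation, on which the quotient does not depend. *)
Definition face_mean_curvature F N m n (H : R) : Prop :=
  exists e1 e2,
    [/\ orthonormal e1 e2, face_in_plane e1 e2 F m n, face_in_plane e1 e2 N m n,
        area e1 e2 F m n != 0 &
        H = - (mixed_area e1 e2 F N m n / area e1 e2 F m n)].

Record cmc F N (H : R) : Prop := Cmc {
  cmc_sphere : forall m n, sqnorm (F m n) = 1 /\ sqnorm (N m n) = 1;
  cmc_planar : planar_faces F /\ planar_faces N;
  cmc_parallel : edge_parallel F N;
  cmc_orthogonal : forall m n, dot (F m n) (N m n) = 0;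
  cmc_curvature : forall m n, face_mean_curvature F N m n H }.

(* The edges of G must not vanish, otherwise a constant G would be a dual of
   every net with planar faces. *)
Record christoffel_dual F G : Prop := ChristoffelDual {
  dual_edges : forall m n, G (m + 1) n != G m n /\ G m (n + 1) != G m n;
  dual_parallel : edge_parallel F G;
  dual_area : forall m n, exists e1 e2,
    [/\ orthonormal e1 e2, face_in_plane e1 e2 F m n, face_in_plane e1 e2 G m n &
        mixed_area e1 e2 F G m n = 0] }.

Definition isothermic F : Prop :=
  circular_faces F /\ exists G, christoffel_dual F G.

Definition isothermic_cmc F N : Prop :=
  isothermic F /\ exists H, cmc F N H.

Definition conformal_metric F s : Prop :=
  (forall m n, s m n != 0) /\
  exists2 G, christoffel_dual F G & forall m n,
    G (m + 1) n - G m n = (s m n * s (m + 1) n)^-1 *: (F (m + 1) n - F m n) /\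
    G m (n + 1) - G m n = (s m n * s m (n + 1))^-1 *: (F m (n + 1) - F m n).

Definition black_white_rescaling s t : Prop :=
  exists c0 c1 : R, [/\ c0 != 0, c1 != 0 &
    forall m n, t m n = (if (2 %| (m + n)%R)%Z then c0 else c1) * s m n].

Definition cross_ratio F m n : 'M[R[i]]_2 :=
  let f := quat (F m n) in let f1 := quat (F (m + 1) n) in
  let f12 := quat (F (m + 1) (n + 1)) in let f2 := quat (F m (n + 1)) in
  (f - f1) *m invmx (f1 - f12) *m (f12 - f2) *m invmx (f2 - f).

End Nets.

(* Main.v *)
Require Import Defs.
From HB Require Import structures.
From mathcomp Require Import all_boot all_order all_algebra.
From mathcomp Require Import ring lra zify.
From mathcomp Require Import spectral complex.
From mathcomp Require Import all_classical all_reals all_analysis.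
Import Order.TTheory GRing.Theory Num.Theory.
Import numFieldNormedType.Exports.
Local Open Scope ring_scope.
Local Open Scope complex_scope.

Set Implicit Arguments.
Unset Strict Implicit.
Unset Printing Implicit Defensive.

(** Put [w = expi ((g2 - g1) / 2)], so that [M = diag (w, w^-1)], and
    [e = l1 w]; then [l2 = e^2 / l1], and the spectral parameters are opposite
    iff [e^4 = 1]. In that case the antidiagonal involution [T = reflection e]
    satisfies [T U(l2) T = U(l1)^-1] and
    [M U(l2) - U(l1) M = (u / alpha) (l1^2 - l1^-2) T], whence
    [F_1 - F = (u / alpha) (l1^2 - l1^-2) Phi(l1)^-1 T Phi_1(l2)]; the edge of
    [N] is [- (cos (2 g1) + u^-2) / sin (2 g1)] times this one. Since
    [V(l) = U(i l)] up to renaming the coefficients, the other family of edges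
    is obtained from [i l1], [i e], and the cross ratio follows from
    [(reflection e * reflection (i e))^2 = -1].

    Hence [N + H F] has edges proportional to [- u^-2 (F_1 - F)] and
    [v^-2 (F_2 - F)]. Its closing condition expresses the diagonal of a face
    by the edges, and the mixed area with [F] vanishes because the
    compatibility condition gives [u u' = v v'] on opposite edges.

    Equality of [alpha] at [l1] and [l2] holds up to sign by the determinant,
    and the sign is constant because [alpha] is continuous along the frame.
    Conversely, on an edge with [a <> 0] parallelism of [F] and [N] forces
    [alpha(l1) = alpha(l2)], so that [l1^2 = l2^2] or [l1^2 l2^2 = 1]; in the
    first case [F] is constant. *)

(** * Induction on the integers and lattice functions with prescribed edge products *)

Section IntegerLattice.

(** An equivalence between neighbours can be followed from 0 in both directions, so one step serves
    positive and negative integers alike. *)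
Lemma int_ind_iff (P : int -> Prop) :
  P 0 -> (forall m, P m <-> P (m + 1)) -> forall m, P m.
Proof.
move=> P0 PS; elim/int_rect => [//|n /PS|n Pn]; first by rewrite addrC -intS.
by apply/PS; rewrite intS opprD addrAC addNr add0r.
Qed.

Lemma int2_ind_iff (P : int -> int -> Prop) :
  P 0 0 -> (forall m n, P m n <-> P (m + 1) n) ->
  (forall m n, P m n <-> P m (n + 1)) -> forall m n, P m n.
Proof.
move=> P0 P1 P2 m; apply: int_ind_iff => [|n]; last exact: P2.
by move: m; apply: int_ind_iff.
Qed.

Variable R : fieldType.

(** This solves $x_k x_{k+1} = f(k)$ with $x_0 = x$. *)
Fixpoint nat_chain (f : nat -> R) (x : R) (n : nat) : R :=
  if n is k.+1 then f k / nat_chain f x k else x.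

Lemma nat_chain_neq0 f x n :
  x != 0 -> (forall k, f k != 0) -> nat_chain f x n != 0.
Proof. by move=> x0 f0; elim: n => //= n IH; rewrite mulf_neq0 // invr_eq0. Qed.

(** As [Negz k] is $-(k+1)$, the edge from [Negz k] to $-k$ carries the value [f (Negz k)], and the
    leftward recursion takes [n.+1] steps from 0 to [Negz n]. *)
Definition int_chain (f : int -> R) (x : R) (m : int) : R :=
  match m with
  | Posz n => nat_chain (fun k => f k%:Z) x n
  | Negz n => nat_chain (fun k => f (Negz k)) x n.+1
  end.

Lemma int_chain_neq0 f x m :
  x != 0 -> (forall k, f k != 0) -> int_chain f x m != 0.
Proof.
by case: m => n x0 f0; rewrite /int_chain nat_chain_neq0 // => k; exact: f0.
Qed.

Lemma int_chainM f x m : x != 0 -> (forall k, f k != 0) ->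
  int_chain f x m * int_chain f x (m + 1) = f m.
Proof.
move=> x0 f0; case: m => n.
  rewrite [Posz n + 1]addrC -intS /= mulrC divfK //.
  by apply: nat_chain_neq0 => // k; exact: f0.
rewrite NegzE intS opprD addrAC addNr add0r.
have h : nat_chain (fun k => f (Negz k)) x n != 0.
  by apply: nat_chain_neq0 => // k; exact: f0.
by rewrite -opprD -intS -NegzE; case: n h => [|n] h; rewrite /= divfK // ?NegzE.
Qed.

(** The product of the four values on a face is the product over either pair of opposite edges,
    which is the compatibility of [P] and [Q]. The row $n = 0$ is filled from [P] and every column
    from [Q]; the compatibility then carries the relation for [P] from row to row in both
    directions. *)
Lemma lattice_chain (P Q : int -> int -> R) :
  (forall m n, P m n != 0) -> (forall m n, Q m n != 0) ->
  (forall m n, P m n * P m (n + 1) = Q m n * Q (m + 1) n) ->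
  exists s : int -> int -> R, forall m n,
    [/\ s m n != 0, s m n * s (m + 1) n = P m n & s m n * s m (n + 1) = Q m n].
Proof.
move=> P0 Q0 PQ.
pose r := int_chain (fun m => P m 0) 1.
have r0 m : r m != 0 by apply: int_chain_neq0; rewrite ?oner_neq0.
pose s m := int_chain (Q m) (r m).
have s0 m n : s m n != 0 by apply: int_chain_neq0.
have sQ m n : s m n * s m (n + 1) = Q m n by apply: int_chainM.
have sP m n : s m n * s (m + 1) n = P m n.
  move: n; apply: int_ind_iff => [|n].
    exact: (@int_chainM (fun m => P m 0) 1 m (oner_neq0 _)).
  have E : (s m n * s (m + 1) n) * (s m (n + 1) * s (m + 1) (n + 1))
           = P m n * P m (n + 1) by rewrite PQ -!sQ; ring.
  split=> h; move: E; rewrite h.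
    by move/(mulfI (P0 _ _)).
  by move/(mulIf (P0 _ _)).
by exists s.
Qed.

End IntegerLattice.

(** * Euclidean geometry of four-space *)

Section Vectors.
Variable R : realType.
Implicit Types (x y z e : 'rV[R]_4) (F G : int -> int -> 'rV[R]_4).

Lemma dotC x y : dot x y = dot y x.
Proof. by apply: eq_bigr => i _; rewrite mulrC. Qed.

Lemma dotDl x y e : dot (x + y) e = dot x e + dot y e.
Proof. by rewrite /dot -big_split; apply: eq_bigr => i _; rewrite mxE mulrDl. Qed.

Lemma dotZl c x e : dot (c *: x) e = c * dot x e.
Proof. by rewrite /dot mulr_sumr; apply: eq_bigr => i _; rewrite mxE mulrA. Qed.

Lemma dotNl x e : dot (- x) e = - dot x e.
Proof. by rewrite -scaleN1r dotZl mulN1r. Qed.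

Lemma dotDr x y e : dot e (x + y) = dot e x + dot e y.
Proof. by rewrite dotC dotDl !(dotC e). Qed.

Lemma dotZr c x e : dot e (c *: x) = c * dot e x.
Proof. by rewrite dotC dotZl (dotC e). Qed.

Lemma dotNr x e : dot e (- x) = - dot e x.
Proof. by rewrite dotC dotNl (dotC e). Qed.

Definition dotE := (dotDl, dotNl, dotZl, dotDr, dotNr, dotZr).

Lemma sqnorm_eq0 x : (sqnorm x == 0) = (x == 0).
Proof.
apply/eqP/eqP => [h|->]; last by rewrite /sqnorm -(scale0r 0) dotZl mul0r.
apply/rowP => i; rewrite mxE; apply/eqP; rewrite -sqrf_eq0 expr2; apply/eqP.
by apply: (psumr_eq0P _ h) => // j _; rewrite -expr2 sqr_ge0.
Qed.

Lemma sqnorm_gt0 x : (0 < sqnorm x) = (x != 0).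
Proof.
rewrite lt0r sqnorm_eq0 andb_idr // => _.
by apply: sumr_ge0 => i _; rewrite -expr2 sqr_ge0.
Qed.

Lemma sqnormZ c x : sqnorm (c *: x) = c ^+ 2 * sqnorm x.
Proof. by rewrite /sqnorm !dotE; ring. Qed.

Lemma sqnormD x y : sqnorm (x + y) = sqnorm x + 2 * dot x y + sqnorm y.
Proof. by rewrite /sqnorm !dotE (dotC y x); ring. Qed.

Lemma in_spanD e1 e2 x y :
  in_span e1 e2 x -> in_span e1 e2 y -> in_span e1 e2 (x + y).
Proof.
move=> [p [q ->]] [p' [q' ->]]; exists (p + p'), (q + q').
by rewrite !scalerDl addrACA.
Qed.

Lemma in_spanZ e1 e2 c x : in_span e1 e2 x -> in_span e1 e2 (c *: x).
Proof. by move=> [p [q ->]]; exists (c * p), (c * q); rewrite scalerDr !scalerA. Qed.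

Lemma in_spanB e1 e2 x y :
  in_span e1 e2 x -> in_span e1 e2 y -> in_span e1 e2 (x - y).
Proof. by move=> hx hy; apply: in_spanD hx _; rewrite -scaleN1r; apply: in_spanZ. Qed.

Definition independent x y : Prop :=
  forall p q : R, p *: x + q *: y = 0 -> p = 0 /\ q = 0.

Lemma independent_neq0 x y : independent x y -> x != 0 /\ y != 0.
Proof.
move=> h; split; apply/eqP => e.
  by have [] := h 1 0; rewrite ?e ?scaler0 ?scale0r ?addr0 // => /eqP; rewrite oner_eq0.
by have [] := h 0 1; rewrite ?e ?scaler0 ?scale0r ?addr0 // => _ /eqP; rewrite oner_eq0.
Qed.

(** Gram-Schmidt: [y'] below is the component of [y] orthogonal to [x]. *)
Lemma independent_orthonormal x y : independent x y ->
  exists e1 e2, [/\ Defs.orthonormal e1 e2, in_span e1 e2 x & in_span e1 e2 y].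
Proof.
move=> h; have [x0 y0] := independent_neq0 h.
have nz z : z != 0 -> Num.sqrt (sqnorm z) != 0.
  by move=> z0; rewrite sqrtr_eq0 -ltNge sqnorm_gt0.
have unit z : z != 0 -> sqnorm ((Num.sqrt (sqnorm z))^-1 *: z) = 1.
  move=> z0; rewrite sqnormZ exprVn sqr_sqrtr ?mulVf ?sqnorm_eq0 //.
  by rewrite ltW // sqnorm_gt0.
pose y' := y - (dot y x / sqnorm x) *: x.
have y'0 : y' != 0.
  apply/eqP => e; have [] := h (- (dot y x / sqnorm x)) 1.
    by rewrite scale1r scaleNr addrC.
  by move=> _ /eqP; rewrite oner_eq0.
have xy' : dot x y' = 0.
  by rewrite /y' !dotE (dotC y) /sqnorm divfK ?subrr // -/(sqnorm x) sqnorm_eq0.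
exists ((Num.sqrt (sqnorm x))^-1 *: x), ((Num.sqrt (sqnorm y'))^-1 *: y'); split.
- by split; rewrite ?unit // dotZl dotZr xy' !mulr0.
- exists (Num.sqrt (sqnorm x)), 0.
  by rewrite scale0r addr0 scalerA mulfV ?scale1r // nz.
- exists (dot y x / sqnorm x * Num.sqrt (sqnorm x)), (Num.sqrt (sqnorm y')).
  by rewrite !scalerA mulfK ?nz // mulfV ?nz // scale1r addrC subrK.
Qed.

Definition wedge e1 e2 x y : R := dot x e1 * dot y e2 - dot x e2 * dot y e1.

(** For $x = p e_1 + q e_2$ and $y = r e_1 + s e_2$ the wedge is $ps - qr$. If it vanishes, then $s
    x - q y = 0$ and $r x - p y = 0$, so independence gives $p = q = 0$ and $x = 0$. *)
Lemma wedge_neq0 e1 e2 x y : Defs.orthonormal e1 e2 -> in_span e1 e2 x ->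
  in_span e1 e2 y -> independent x y -> wedge e1 e2 x y != 0.
Proof.
case; rewrite /sqnorm /wedge => e11 e22 e12 [p [q ->]] [r [s ->]] h.
rewrite !dotE (dotC e2 e1) e11 e22 e12 !mulr0 !mulr1 !addr0 !add0r.
apply/eqP => E.
have [x0 _] := independent_neq0 h; move: x0.
have [] := h s (- q).
  rewrite scaleNr !scalerDr !scalerA opprD addrACA -!scalerBl.
  by rewrite (mulrC s) E (mulrC q s) subrr !scale0r addr0.
have [] := h r (- p).
  rewrite scaleNr !scalerDr !scalerA opprD addrACA -!scalerBl (mulrC r p) subrr.
  by rewrite -[r * q - _]opprB (mulrC r) E oppr0 !scale0r addr0.
move=> _ /eqP; rewrite oppr_eq0 => /eqP -> _ /eqP; rewrite oppr_eq0 => /eqP ->.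
by rewrite !scale0r addr0 eqxx.
Qed.

End Vectors.

(** * Areas, edge factors and circular faces *)

Section Faces.
Variable R : realType.
Implicit Types (x y z e : 'rV[R]_4) (F G : int -> int -> 'rV[R]_4).

Definition edge1 F (m n : int) : 'rV[R]_4 := F (m + 1) n - F m n.
Definition edge2 F (m n : int) : 'rV[R]_4 := F m (n + 1) - F m n.
Definition face_diagonal F (m n : int) : 'rV[R]_4 := F (m + 1) (n + 1) - F m n.

(** The shoelace sum of a quad is the wedge of its diagonals; the difference of the edges is the
    diagonal from vertex 1 to vertex 2. *)
Lemma area_diagonal e1 e2 F m n : area e1 e2 F m n =
  2^-1 * wedge e1 e2 (face_diagonal F m n) (edge2 F m n - edge1 F m n).
Proof. by rewrite /area /wedge /face_diagonal /edge1 /edge2 !dotE; ring. Qed.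

Lemma mixed_area_diagonal e1 e2 F G m n : mixed_area e1 e2 F G m n =
  4^-1 * (wedge e1 e2 (face_diagonal F m n) (edge2 G m n - edge1 G m n)
          + wedge e1 e2 (face_diagonal G m n) (edge2 F m n - edge1 F m n)).
Proof.
rewrite /mixed_area !area_diagonal /wedge /face_diagonal /edge1 /edge2 !dotE.
by field.
Qed.

Definition edge_factors F G (c d : int -> int -> R) : Prop := forall m n,
  edge1 G m n = c m n *: edge1 F m n /\ edge2 G m n = d m n *: edge2 F m n.

Lemma edge_factors_diagonal F G c d : edge_factors F G c d -> forall m n,
  face_diagonal G m n = c m n *: edge1 F m n
                   + d (m + 1) n *: (face_diagonal F m n - edge1 F m n).
Proof.
move=> h m n; have [<- _] := h m n; have [_ h2] := h (m + 1) n.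
have -> : face_diagonal F m n - edge1 F m n = edge2 F (m + 1) n.
  by apply/rowP => i; rewrite !mxE; ring.
by rewrite -h2; apply/rowP => i; rewrite !mxE; ring.
Qed.

(** Both paths of [G] to the far vertex have the same sum, and both are expressed by edges and
    diagonal of [F]. When the factors on the two edges at the far vertex differ, this determines the
    diagonal. *)
Lemma edge_factors_closing F G c d : edge_factors F G c d -> forall m n,
  (d (m + 1) n - c m (n + 1)) *: face_diagonal F m n
  = (d (m + 1) n - c m n) *: edge1 F m n
    + (d m n - c m (n + 1)) *: edge2 F m n.
Proof.
move=> h m n; apply/rowP => i.
have [h1 h2] := h m n; have [_ h3] := h (m + 1) n; have [h4 _] := h m (n + 1).
have := congr1 (fun w : 'rV_4 => w 0 i) h1.
have := congr1 (fun w : 'rV_4 => w 0 i) h2.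
have := congr1 (fun w : 'rV_4 => w 0 i) h3.
have := congr1 (fun w : 'rV_4 => w 0 i) h4.
rewrite /face_diagonal /edge1 /edge2 !mxE => *.
lra.
Qed.

Lemma edge_factors_parallel F G c d : edge_factors F G c d -> edge_parallel F G.
Proof. by move=> h m n; have [h1 h2] := h m n; split; [exists (c m n)|exists (d m n)]; left. Qed.

Lemma edge_factors_comb F G c d r k : edge_factors F G c d ->
  edge_factors F (fun m n => k *: (G m n + r *: F m n))
    (fun m n => k * (c m n + r)) (fun m n => k * (d m n + r)).
Proof.
move=> h m n; have [h1 h2] := h m n.
by split; rewrite -scalerA scalerDl -?h1 -?h2 /edge1 /edge2 -scalerBr opprD
  addrACA scalerBr.
Qed.

Lemma edge_factors_in_plane F G c d e1 e2 m n : edge_factors F G c d ->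
  face_in_plane e1 e2 F m n -> face_in_plane e1 e2 G m n.
Proof.
move=> h [h1 h12 h2]; split.
- by rewrite -/(edge1 G m n) (proj1 (h m n)); apply: in_spanZ.
- rewrite -/(face_diagonal G m n) (edge_factors_diagonal h).
  by apply: in_spanD; apply: in_spanZ => //; apply: in_spanB.
- by rewrite -/(edge2 G m n) (proj2 (h m n)); apply: in_spanZ.
Qed.

(** A plane meets the unit sphere in a circle around the foot [c] of the perpendicular from the
    origin, of squared radius $1 - |c|^2$ by Pythagoras. *)
Lemma spherical_circular_faces F :
  (forall m n, sqnorm (F m n) = 1) -> planar_faces F ->
  (forall m n, edge1 F m n != 0) -> circular_faces F.
Proof.
move=> F1 Fpl Fe m n; have [e1 [e2 [oe [h1 h12 h2]]]] := Fpl m n.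
have [e11 e22 e12] := oe; rewrite /sqnorm in e11 e22.
pose f1 := dot (F m n) e1; pose f2 := dot (F m n) e2.
pose c : 'rV[R]_4 := F m n - (f1 *: e1 + f2 *: e2).
have ce1 : dot c e1 = 0.
  by rewrite /c !dotE e11 (dotC e2) e12 -/f1; ring.
have ce2 : dot c e2 = 0.
  by rewrite /c !dotE e22 e12 -/f2; ring.
have span x : in_span e1 e2 (x - F m n) -> in_span e1 e2 (x - c).
  move=> hx; have -> : x - c = (x - F m n) + (f1 *: e1 + f2 *: e2).
    by rewrite /c opprB addrA addrAC.
  by apply: in_spanD hx _; exists f1, f2.
have pyth x : in_span e1 e2 (x - c) -> sqnorm x = sqnorm c + sqnorm (x - c).
  move=> [p [q E]]; rewrite -{1}[x](subrKC c) E (sqnormD c) dotDr !dotZr ce1 ce2.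
  by ring.
(* A plane tangent to the sphere touches it in one point only, which would make the edge vanish. *)
have r0 : 0 < 1 - sqnorm c.
  have hF : in_span e1 e2 (F m n - F m n).
    by exists 0, 0; rewrite subrr !scale0r addr0.
  rewrite -(F1 m n) (pyth _ (span _ hF)) [X in X - _]addrC addrK sqnorm_gt0.
  apply/eqP => E; have := Fe m n; rewrite -sqnorm_eq0 /edge1.
  have Ec : F m n = c by apply/eqP; rewrite -subr_eq0 E.
  have := pyth _ (span _ h1); rewrite -Ec !F1 => /eqP.
  by rewrite -subr_eq0 opprD addrA subrr add0r oppr_eq0 => ->.
exists c, e1, e2, (Num.sqrt (1 - sqnorm c)); split; rewrite ?sqrtr_gt0 //.
rewrite sqr_sqrtr; last exact: ltW.
have main k l : in_span e1 e2 (F k l - F m n) ->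
    in_span e1 e2 (F k l - c) /\ sqnorm (F k l - c) = 1 - sqnorm c.
  move=> hx; split; first exact: span.
  by have := pyth _ (span _ hx); rewrite F1 => ->; ring.
move=> x; rewrite !inE => /or4P[] /eqP->; apply: main => //.
by exists 0, 0; rewrite subrr !scale0r addr0.
Qed.

End Faces.

(** * Duals, curvature and conformal metrics from edge factors [rho + tau * p] and
    [rho - tau * q] *)

Section DualNets.
Variable R : realType.
Variables (F N : int -> int -> 'rV[R]_4) (p q : int -> int -> R) (rho tau : R).
Hypothesis p_gt0 : forall m n, 0 < p m n.
Hypothesis q_gt0 : forall m n, 0 < q m n.
Hypothesis pq : forall m n, p m n * p m (n + 1) = q m n * q (m + 1) n.
Hypothesis tau_neq0 : tau != 0.
Hypothesis FN : edge_factors F N (fun m n => rho + tau * p m n)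
                                 (fun m n => rho - tau * q m n).
Hypothesis F_indep : forall m n, independent (edge1 F m n) (edge2 F m n).

(** Times [- tau], this is the difference of the edge factors on the two edges meeting at the far
    vertex of the face. *)
Let D (m n : int) := p m (n + 1) + q (m + 1) n.

Let D_gt0 m n : 0 < D m n.
Proof. by rewrite addr_gt0. Qed.

Let D_neq0 m n : D m n != 0.
Proof. by rewrite gt_eqF. Qed.

(** This is the closing condition, in which [rho] cancels, divided by [- tau * D m n]. It makes the
    faces planar and reduces all areas to the wedge of the two edges. *)
Lemma diagonal_edges m n : face_diagonal F m n =
  ((p m n + q (m + 1) n) / D m n) *: edge1 F m n
  + ((q m n + p m (n + 1)) / D m n) *: edge2 F m n.
Proof.
have c0 : - tau * D m n != 0 by rewrite mulf_neq0 // oppr_eq0.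
apply: (scalerI c0); rewrite [RHS]scalerDr !scalerA.
have := edge_factors_closing FN m n.
have -> : rho - tau * q (m + 1) n - (rho + tau * p m (n + 1)) = - tau * D m n.
  by rewrite /D; ring.
move=> ->; have := D_neq0 m n; rewrite /D => D0.
by congr (_ *: _ + _ *: _); field.
Qed.

Lemma face_plane m n :
  exists e1 e2, Defs.orthonormal e1 e2 /\ face_in_plane e1 e2 F m n.
Proof.
have [e1 [e2 [oe hx hy]]] := independent_orthonormal (@F_indep m n).
exists e1, e2; split=> //; split=> //.
rewrite -/(face_diagonal F m n) diagonal_edges.
by apply: in_spanD; apply: in_spanZ.
Qed.

Lemma face_wedge_neq0 e1 e2 m n : Defs.orthonormal e1 e2 ->
  face_in_plane e1 e2 F m n -> wedge e1 e2 (edge1 F m n) (edge2 F m n) != 0.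
Proof. by move=> oe [h1 _ h2]; apply: wedge_neq0. Qed.

Lemma face_area e1 e2 m n : area e1 e2 F m n =
  2^-1 * ((p m n + q (m + 1) n + q m n + p m (n + 1)) / D m n
          * wedge e1 e2 (edge1 F m n) (edge2 F m n)).
Proof.
rewrite area_diagonal diagonal_edges /wedge !dotE; have := D_neq0 m n.
by rewrite /D => D0; field.
Qed.

Lemma face_area_neq0 e1 e2 m n : Defs.orthonormal e1 e2 ->
  face_in_plane e1 e2 F m n -> area e1 e2 F m n != 0.
Proof.
move=> oe hF; rewrite face_area !mulf_neq0 ?invr_eq0 ?face_wedge_neq0 ?D_neq0 //.
by rewrite gt_eqF // !addr_gt0.
Qed.

(** Mixed area is linear in [G]: the constant part of the factors contributes [r] times the area of
    [F], and the rest is a multiple of the difference of products that [pq] annihilates. The case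
    [r = 0] yields Christoffel duals, the case [r = rho] the mean curvature. *)
Lemma mixed_area_factors G r k e1 e2 m n :
  edge_factors F G (fun m n => r + k * p m n) (fun m n => r - k * q m n) ->
  mixed_area e1 e2 F G m n = r * area e1 e2 F m n.
Proof.
move=> FG.
transitivity (r * area e1 e2 F m n + k / 2 / D m n
    * (p m n * p m (n + 1) - q m n * q (m + 1) n)
    * wedge e1 e2 (edge1 F m n) (edge2 F m n)).
  rewrite face_area mixed_area_diagonal (edge_factors_diagonal FG).
  have [-> ->] := FG m n; rewrite diagonal_edges /wedge !dotE.
  by have := D_neq0 m n; rewrite /D => D0; field.
by rewrite pq subrr mulr0 mul0r addr0.
Qed.

Lemma christoffel_dual_factors G k : k != 0 ->
  edge_factors F G (fun m n => - (k * p m n)) (fun m n => k * q m n) ->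
  christoffel_dual F G.
Proof.
move=> k0 FG.
have FG' : edge_factors F G (fun m n => 0 + (- k) * p m n)
                            (fun m n => 0 - (- k) * q m n).
  by move=> m n; rewrite !add0r !mulNr opprK.
split; last 1 first.
- move=> m n; have [e1 [e2 [oe hF]]] := face_plane m n; exists e1, e2; split=> //.
    exact: edge_factors_in_plane FG hF.
  by rewrite (mixed_area_factors _ _ _ _ FG') mul0r.
- move=> m n; have [x0 y0] := independent_neq0 (@F_indep m n).
  have [h1 h2] := FG m n.
  rewrite -subr_eq0 -/(edge1 G m n) h1 -[G m (n + 1) == _]subr_eq0.
  rewrite -/(edge2 G m n) h2 !scaler_eq0 !negb_or x0 y0 oppr_eq0.
  by rewrite !mulf_eq0 !negb_or k0 !gt_eqF.
- exact: edge_factors_parallel FG.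
Qed.

Lemma planar_faces_pair : planar_faces F /\ planar_faces N.
Proof.
split=> m n; have [e1 [e2 [oe hF]]] := face_plane m n; exists e1, e2; split=> //.
exact: edge_factors_in_plane FN hF.
Qed.

Lemma cmc_factors :
  (forall m n, sqnorm (F m n) = 1 /\ sqnorm (N m n) = 1) ->
  (forall m n, dot (F m n) (N m n) = 0) -> cmc F N (- rho).
Proof.
move=> FN1 FN0; split=> //.
- exact: planar_faces_pair.
- exact: edge_factors_parallel FN.
- move=> m n; have [e1 [e2 [oe hF]]] := face_plane m n; exists e1, e2.
  have A0 := face_area_neq0 oe hF.
  split=> //; first exact: edge_factors_in_plane FN hF.
  by rewrite (mixed_area_factors _ _ _ _ FN) mulfK.
Qed.

(* The closing condition on a face is quadratic in the edge factors of a
   conformal metric: one solution makes all of them equal, which the mixed area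
   excludes, and the other one is proportional to [- p], [q]. *)
Lemma conformal_metric_face t : conformal_metric F t -> forall m n,
  exists k, [/\ (t m n * t (m + 1) n)^-1 = - (k * p m n),
    (t m n * t m (n + 1))^-1 = k * q m n,
    (t m (n + 1) * t (m + 1) (n + 1))^-1 = - (k * p m (n + 1)) &
    (t (m + 1) n * t (m + 1) (n + 1))^-1 = k * q (m + 1) n].
Proof.
move=> [t0 [G dG tG]] m n.
pose P m n := (t m n * t (m + 1) n)^-1; pose Q m n := (t m n * t m (n + 1))^-1.
have FG : edge_factors F G P Q by [].
rewrite -/(P m n) -/(P m (n + 1)) -/(Q m n) -/(Q (m + 1) n).
have D0 := D_neq0 m n; rewrite /D in D0.
have q'0 : q (m + 1) n != 0 by rewrite gt_eqF.
have p'0 : p m (n + 1) != 0 by rewrite gt_eqF.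
(* Both sides are the inverse of the product of [t] over the four vertices. *)
have PQ : P m n * P m (n + 1) = Q m n * Q (m + 1) n.
  by rewrite /P /Q -!invfM; congr _^-1; ring.
have [e1 [e2 [oe hF hG mG]]] := dual_area dG m n.
have := edge_factors_closing FG m n.
rewrite diagonal_edges scalerDr !scalerA => /eqP.
rewrite -subr_eq0 opprD addrACA -!scalerBl => /eqP /F_indep [].
rewrite /D => Ex Ey.
have P1E : P m n = Q (m + 1) n + (P m (n + 1) - Q (m + 1) n)
    * ((p m n + q (m + 1) n) / (p m (n + 1) + q (m + 1) n)).
  by apply/eqP; rewrite -subr_eq0 -Ex; apply/eqP; ring.
have Q1E : Q m n = P m (n + 1) + (Q (m + 1) n - P m (n + 1))
    * ((q m n + p m (n + 1)) / (p m (n + 1) + q (m + 1) n)).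
  by apply/eqP; rewrite eq_sym -subr_eq0 -Ey; apply/eqP; ring.
have Q0 : Q (m + 1) n != 0 by rewrite invr_eq0 mulf_neq0.
have PQ2 : P m (n + 1) != Q (m + 1) n.
  apply: contraNneq (face_area_neq0 oe hF) => E.
  have cF : mixed_area e1 e2 F G m n = Q (m + 1) n * area e1 e2 F m n.
    rewrite mixed_area_diagonal (edge_factors_diagonal FG) area_diagonal.
    have [-> ->] := FG m n; rewrite P1E Q1E E subrr !mul0r !addr0 /wedge !dotE.
    by field.
  by move: mG; rewrite cF => /eqP; rewrite mulf_eq0 (negPf Q0).
(* Substituting [P1E] and [Q1E] into [PQ] gives a product of this sum with the difference excluded
   from vanishing by [PQ2]. *)
have key : (p m n + q (m + 1) n) * P m (n + 1)
           + (q m n + p m (n + 1)) * Q (m + 1) n = 0.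
  have E : (P m (n + 1) - Q (m + 1) n)
      * ((p m n + q (m + 1) n) * P m (n + 1)
           + (q m n + p m (n + 1)) * Q (m + 1) n)
      = (P m n * P m (n + 1) - Q m n * Q (m + 1) n)
         * (p m (n + 1) + q (m + 1) n).
    by rewrite P1E Q1E; field.
  move: E; rewrite PQ subrr mul0r => /eqP.
  by rewrite mulf_eq0 subr_eq0 (negPf PQ2) /= => /eqP.
have P2E : P m (n + 1) = - (Q (m + 1) n / q (m + 1) n * p m (n + 1)).
  have B0 : q m n + p m (n + 1) != 0 by rewrite gt_eqF // addr_gt0.
  apply: (mulfI B0); apply: (mulfI q'0).
  (* By [pq] the two coefficients in [key] are in the ratio of [q (m + 1) n] to [p m (n + 1)]. *)
  have Ap : (p m n + q (m + 1) n) * p m (n + 1)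
            = q (m + 1) n * (q m n + p m (n + 1)).
    by rewrite mulrDl pq; ring.
  have -> : q (m + 1) n * ((q m n + p m (n + 1)) * P m (n + 1))
     = p m (n + 1) * ((p m n + q (m + 1) n) * P m (n + 1)).
    by rewrite !mulrA -Ap; ring.
  have -> : (p m n + q (m + 1) n) * P m (n + 1)
            = - ((q m n + p m (n + 1)) * Q (m + 1) n).
    by apply/eqP; rewrite -addr_eq0 key.
  by field.
exists (Q (m + 1) n / q (m + 1) n); split=> //.
- by rewrite P1E P2E; field; rewrite q'0.
- by rewrite Q1E P2E; field; rewrite q'0.
- by rewrite divfK.
Qed.

(** Adjacent faces share an edge, on which their constants must agree, so that one constant serves
    the whole lattice. The [k] produced here is its inverse. *)
Lemma conformal_metric_edges t : conformal_metric F t ->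
  exists2 k, k != 0 & forall m n,
    t m n * t (m + 1) n = - (k / p m n) /\ t m n * t m (n + 1) = k / q m n.
Proof.
move=> ht; have [t0 _] := ht.
have q0 m n : q m n != 0 by rewrite gt_eqF.
have p0 m n : p m n != 0 by rewrite gt_eqF.
pose k m n := (t m n * t m (n + 1))^-1 / q m n.
have E m n : [/\ (t m n * t (m + 1) n)^-1 = - (k m n * p m n),
    (t m n * t m (n + 1))^-1 = k m n * q m n,
    (t m (n + 1) * t (m + 1) (n + 1))^-1 = - (k m n * p m (n + 1)) &
    (t (m + 1) n * t (m + 1) (n + 1))^-1 = k m n * q (m + 1) n].
  have [c [E1 E2 E3 E4]] := conformal_metric_face ht m n.
  by have -> : k m n = c; rewrite /k ?E2 ?mulfK.
have k1 m n : k (m + 1) n = k m n.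
  have [_ _ _ E4] := E m n; have [_ E2 _ _] := E (m + 1) n.
  by move: E4; rewrite E2 => /(mulIf (q0 _ _)).
have k2 m n : k m (n + 1) = k m n.
  have [_ _ E3 _] := E m n; have [E1 _ _ _] := E m (n + 1).
  by move: E3; rewrite E1 => /oppr_inj /(mulIf (p0 _ _)).
have kE m n : k m n = k 0 0.
  move: m n; apply: int2_ind_iff => // m n; first by rewrite k1.
  by rewrite k2.
exists (k 0 0)^-1; first by rewrite invr_eq0 /k mulf_neq0 ?invr_eq0 // mulf_neq0.
move=> m n; have [E1 E2 _ _] := E m n; rewrite kE in E1 E2.
by split; rewrite -[LHS]invrK ?E1 ?E2 ?invrN invfM.
Qed.

(** The quotient [r] of the two metrics has the same product [k' / k] over every edge, hence
    alternates between two values on the black and white vertices. *)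
Lemma conformal_metric_unique s t :
  conformal_metric F s -> conformal_metric F t -> black_white_rescaling s t.
Proof.
move=> hs ht; have [s0 _] := hs; have [t0 _] := ht.
have [k k0 Es] := conformal_metric_edges hs.
have [k' k'0 Et] := conformal_metric_edges ht.
have q0 m n : q m n != 0 by rewrite gt_eqF.
have p0 m n : p m n != 0 by rewrite gt_eqF.
pose r m n := t m n / s m n.
have r0 m n : r m n != 0 by rewrite mulf_neq0 ?invr_eq0.
have r1 m n : r m n * r (m + 1) n = k' / k.
  rewrite /r mulrACA -invfM (proj1 (Es m n)) (proj1 (Et m n)).
  by field; rewrite k0 p0.
have r2 m n : r m n * r m (n + 1) = k' / k.
  rewrite /r mulrACA -invfM (proj2 (Es m n)) (proj2 (Et m n)).
  by field; rewrite k0 q0.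
pose c0 := r 0 0; pose c1 := k' / k / c0.
have c00 : c0 != 0 by exact: r0.
have c10 : c1 != 0 by apply: mulf_neq0; rewrite ?mulf_neq0 ?invr_eq0.
exists c0, c1; split=> //.
suff rE m n : r m n = if (2 %| (m + n)%R)%Z then c0 else c1.
  by move=> m n; rewrite -rE /r divfK.
have cc : c0 * c1 = k' / k by rewrite /c1 mulrC divfK.
(* Across an edge the parity flips, and the product [c0 * c1] determines the value at either end
   from the other. *)
have step x y (b : bool) : x * y = k' / k ->
    (x = if b then c0 else c1) <-> (y = if ~~ b then c0 else c1).
  move=> xy; split=> E; move: xy; rewrite -cc E; case: b {E} => /=.
  - exact/mulfI/r0.
  - by rewrite [RHS]mulrC; apply/mulfI.
  - by move/(mulIf c10).
  - by rewrite mulrC; apply/mulfI/r0.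
have par1 m' n' : (2 %| (m' + 1 + n')%R)%Z = ~~ (2 %| (m' + n')%R)%Z by lia.
have par2 m' n' : (2 %| (m' + (n' + 1))%R)%Z = ~~ (2 %| (m' + n')%R)%Z by lia.
move: m n; apply: int2_ind_iff => [//|m n|m n].
  by rewrite par1; apply: step.
by rewrite par2; apply: step.
Qed.

(** The prescribed edge products are compatible by [pq], so [lattice_chain] integrates them; [K] is
    the free scale of the metric. *)
Lemma conformal_metric_exists K : K != 0 ->
  exists2 s, conformal_metric F s & forall m n,
    s m n * s (m + 1) n = - (K / p m n) /\ s m n * s m (n + 1) = K / q m n.
Proof.
move=> K0.
have q0 m n : q m n != 0 by rewrite gt_eqF.
have p0 m n : p m n != 0 by rewrite gt_eqF.
have [|||s Es] := @lattice_chain _ (fun m n => - (K / p m n))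
                                   (fun m n => K / q m n).
- by move=> m n; rewrite oppr_eq0 mulf_neq0 ?invr_eq0.
- by move=> m n; rewrite mulf_neq0 ?invr_eq0.
- by move=> m n; rewrite mulrNN !mulf_div pq.
exists s; last by move=> m n; have [] := Es m n.
split; first by move=> m n; have [] := Es m n.
(* Subtracting [rho *: F] leaves the factors [tau * p] and [- tau * q]; the scalar turns them into
   the inverses of the edge products of [s]. *)
pose G m n := (- (tau * K)^-1) *: (N m n + (- rho) *: F m n).
have tK0 : tau * K != 0 by rewrite mulf_neq0.
have FG : edge_factors F G (fun m n => - (K^-1 * p m n)) (fun m n => K^-1 * q m n).
  have h := edge_factors_comb (- rho) (- (tau * K)^-1) FN.
  move=> m n; have [-> ->] := h m n.
  by split; congr (_ *: _); field; rewrite K0 tau_neq0.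
exists G; first by apply: christoffel_dual_factors FG; rewrite invr_eq0.
move=> m n; have [_ -> ->] := Es m n; rewrite -/(edge1 G m n) -/(edge2 G m n).
have [-> ->] := FG m n.
by rewrite invrN !invfM !invrK.
Qed.

End DualNets.

(** * The unit circle, zeros of the sine and the exponential series *)

Section UnitCircle.
Variable R : realType.
Implicit Types (t : R) (l : R[i]).

Lemma complexP (x y : R[i]) :
  complex.Re x = complex.Re y -> complex.Im x = complex.Im y -> x = y.
Proof. by case: x y => [a b] [c d] /= -> ->. Qed.

Lemma expiD t t' : expi (t + t') = expi t * expi t'.
Proof. by apply: complexP; rewrite /= ?cosD ?sinD // addrC. Qed.

Lemma expi0 : expi 0 = 1 :> R[i].
Proof. by apply: complexP; rewrite /= ?cos0 ?sin0. Qed.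

Lemma expi_neq0 t : expi t != 0.
Proof.
have := expiD t (- t); rewrite subrr expi0 => h.
by apply: contra_eq_neq h => ->; rewrite mul0r oner_eq0.
Qed.

Lemma expiN t : expi (- t) = (expi t)^-1.
Proof.
apply: (mulfI (expi_neq0 t)).
by rewrite -expiD subrr expi0 mulfV // expi_neq0.
Qed.

Lemma expi_sqr t : expi t ^+ 2 = expi (2 * t).
Proof. by rewrite expr2 -expiD mulr2n mulrDl mul1r. Qed.

Lemma norm_expi t : `|expi t| = 1.
Proof. by rewrite normc_def /= cos2Dsin2 sqrtr1. Qed.

Lemma unit_circle_neq0 l : `|l| = 1 -> l != 0.
Proof. by move=> h; rewrite -normr_eq0 h oner_eq0. Qed.

Lemma unit_circle_inv l : `|l| = 1 -> l^-1 = l^*.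
Proof. by move=> h; rewrite invc_norm h expr1n invr1 mul1r. Qed.

Lemma unit_circle_sqr_add l : `|l| = 1 ->
  l ^+ 2 + l ^- 2 = (2 * complex.Re (l ^+ 2))%:C.
Proof.
move=> h; rewrite -exprVn unit_circle_inv // -rmorphXn addcJ rmorphM /=.
by rewrite rmorph_nat.
Qed.

Lemma unit_circle_sqr_sub l : `|l| = 1 ->
  l ^+ 2 - l ^- 2 = (2 * complex.Im (l ^+ 2))%:C * 'i%C.
Proof.
move=> h; rewrite -exprVn unit_circle_inv // -rmorphXn subcJ rmorphM /=.
by rewrite rmorph_nat.
Qed.

Lemma mul_ii : 'i%C * 'i%C = -1 :> R[i].
Proof. by rewrite -expr2 sqr_i. Qed.

Lemma ii_neq0 : 'i%C != 0 :> R[i].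
Proof. by rewrite eq_complex /= oner_eq0 andbF. Qed.

Lemma inv_ii : 'i%C^-1 = - 'i%C :> R[i].
Proof. by apply: (mulfI ii_neq0); rewrite mulfV ?ii_neq0 // mulrN mul_ii opprK. Qed.

Lemma norm_ii : `|'i%C : R[i]| = 1.
Proof. by rewrite normc_def /= expr0n /= add0r expr1n sqrtr1. Qed.

Lemma sin_intpi (k : int) : sin (k%:~R * pi) = 0 :> R.
Proof.
move: k; apply: int_ind_iff => [|k]; first by rewrite mul0r sin0.
rewrite intrD mulrDl mul1r sinDpi.
by split=> /eqP; rewrite ?oppr_eq0 => h; apply/eqP; rewrite ?oppr_eq0.
Qed.

(** Subtracting the largest multiple of pi below [t] leaves an angle in $[0, \pi)$, where the sine
    vanishes only at 0. *)
Lemma sin_eq0 t : sin t = 0 -> exists k : int, t = k%:~R * pi.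
Proof.
move=> st; have pi0 := pi_gt0 R; exists (Num.floor (t / pi)).
set k := Num.floor _.
have /andP[] : k%:~R <= t / pi < (k + 1)%:~R by exact: floor_itv.
rewrite ler_pdivlMr // ltr_pdivrMr // intrD mulrDl mul1r => h1 h2.
apply/eqP; rewrite eq_le h1 andbT leNgt; apply/negP => h.
have : 0 < sin (t - k%:~R * pi).
  by apply: sin_gt0_pi; rewrite subr_gt0 h ltrBlDl.
by rewrite sinD st mul0r sinN sin_intpi oppr0 mulr0 addr0 ltxx.
Qed.

(** The parts are written with [odd] and [half] to match the coefficients of the cosine and sine
    series. *)
Lemma expr_ii n : 'i%C ^+ n =
  ((~~ odd n)%:R * (-1) ^+ n./2) +i* ((odd n)%:R * (-1) ^+ n.-1./2) :> R[i].
Proof.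
have even k : 'i%C ^+ k.*2 = ((-1) ^+ k)%:C :> R[i].
  by rewrite -muln2 mulnC exprM sqr_i rmorphXn rmorphN1.
rewrite -[n]odd_double_half; case: (odd n); rewrite ?[odd _]/=.
  rewrite add1n exprS even /= odd_double /= doubleK.
  by apply: complexP => /=; ring.
rewrite add0n even odd_double doubleK /=.
by apply: complexP => /=; ring.
Qed.

Lemma expi_term t n :
  (n`!%:R)^-1 * (t%:C * 'i%C) ^+ n = cos_coeff t n +i* sin_coeff t n :> R[i].
Proof.
rewrite exprMn expr_ii -rmorphXn /=.
rewrite -(rmorph_nat (real_complex R)) -fmorphV /cos_coeff /sin_coeff /=.
rewrite -[(-1) ^ n./2]/((-1) ^+ n./2); move: (_^-1) => f.
by apply: complexP => /=; ring.
Qed.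

End UnitCircle.

(** * Words in frames, edge matrices and involutions *)

Section MatrixWords.
Variable C : fieldType.
Implicit Types (A B T X Y : 'M[C]_2).

Lemma invmx_eq X Y : X *m Y = 1%:M -> invmx X = Y.
Proof.
move=> XY; have [uX _] := mulmx1_unit XY.
by rewrite -[RHS](mulKmx uX) XY mulmx1.
Qed.

Lemma invmx_mul X Y : X \in unitmx -> Y \in unitmx ->
  invmx (X *m Y) = invmx Y *m invmx X.
Proof. by move=> uX uY; apply: invmx_eq; rewrite mulmxA mulmxK // mulmxV. Qed.

(** [A1], [A2] stand for the frames at one vertex for the two spectral parameters, [Z1], [Z2] for
    the edge matrices. Between the frames remains the gauged difference [M *m Z2 - Z1 *m M], which
    depends on the edge alone. *)
Lemma net_edge (A1 A2 Z1 Z2 M : 'M[C]_2) : A1 \in unitmx -> Z1 \in unitmx ->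
  invmx (Z1 *m A1) *m M *m (Z2 *m A2) - invmx A1 *m M *m A2
  = invmx A1 *m invmx Z1 *m (M *m Z2 - Z1 *m M) *m A2.
Proof.
move=> uA uZ; rewrite invmx_mul //.
by rewrite mulmxBr mulmxBl -!mulmxA (mulKmx uZ).
Qed.

Lemma net_edge_normal (A1 A2 Z1 Z2 K M : 'M[C]_2) :
  A1 \in unitmx -> Z1 \in unitmx ->
  - (invmx (Z1 *m A1) *m K *m M *m (Z2 *m A2)) - - (invmx A1 *m K *m M *m A2)
  = invmx A1 *m invmx Z1 *m (- (K *m M *m Z2 - Z1 *m (K *m M))) *m A2.
Proof.
move=> uA uZ; rewrite -opprD -!(mulmxA _ K M) net_edge //.
by rewrite mulmxN mulNmx.
Qed.

Lemma invmx_scale_involution (z : C) T A B :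
  z != 0 -> A \in unitmx -> B \in unitmx -> T *m T = 1%:M ->
  invmx (z *: (invmx A *m T *m B)) = z^-1 *: (invmx B *m T *m A).
Proof.
move=> z0 uA uB TT; apply: invmx_eq; rewrite -scalemxAl -scalemxAr scalerA mulfV //.
by rewrite scale1r -!mulmxA (mulKVmx uB) (mulmxA T) TT mul1mx mulVmx.
Qed.

Lemma conj_scale_inj A B X Y (z : C) : A \in unitmx -> B \in unitmx ->
  A *m X *m B = z *: (A *m Y *m B) -> X = z *: Y.
Proof.
move=> uA uB; rewrite scalemxAl scalemxAr.
by move=> /(can_inj (mulmxK uB)) /(can_inj (mulKmx uA)).
Qed.

Lemma comb_conj_eq0 A B T T' X Y (x y : C) : A \in unitmx -> B \in unitmx ->
  x *: (invmx A *m T *m (X *m B)) + y *: (invmx A *m T' *m (Y *m B)) = 0 ->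
  x *: (T *m X) + y *: (T' *m Y) = 0.
Proof.
move=> uA uB /(congr1 (fun Z => A *m Z *m invmx B)); rewrite mulmx0 mul0mx => <-.
rewrite mulmxDr mulmxDl -!scalemxAr -!scalemxAl -!mulmxA !(mulKVmx uA).
by rewrite !mulmxV // !mulmx1.
Qed.

Lemma scale_entry X Y (z : C) i j : X = z *: Y -> X i j = z * Y i j.
Proof. by move=> ->; rewrite mxE. Qed.

Lemma comb_entry X Y (x y : C) i j :
  x *: X + y *: Y = 0 -> x * X i j + y * Y i j = 0.
Proof. by move/matrixP/(_ i j); rewrite !mxE. Qed.

(* [Aij] and [Bij] are the frames at the four vertices of a face for the two
   spectral parameters. *)
Lemma cross_ratio_word (A00 A10 A01 B10 B01 B11 T T' U1 V1 U1' V1' U2' V2' : 'M[C]_2) :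
  A00 \in unitmx -> V1 \in unitmx -> B10 \in unitmx -> B01 \in unitmx ->
  A10 = U1 *m A00 -> A01 = V1 *m A00 -> B11 = V2' *m B10 -> B11 = U2' *m B01 ->
  V1' *m U1 = U1' *m V1 ->
  T *m U2' *m T *m U1' = 1%:M -> T' *m V2' *m T' *m V1' = 1%:M ->
  T *m T = 1%:M -> T' *m T' = 1%:M -> (T *m T') *m (T *m T') = - 1%:M ->
  invmx A00 *m T *m B10 *m (invmx B11 *m T' *m A10) *m (invmx A01 *m T *m B11)
  *m (invmx B01 *m T' *m A00) = - 1%:M.
Proof.
move=> uA uV1 uB10 uB01 A10E A01E B11V B11U cp TU TV T1 T2 TT.
have KT X : X *m T *m T = X by rewrite -mulmxA T1 mulmx1.
have KT' X : X *m T' *m T' = X by rewrite -mulmxA T2 mulmx1.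
(* The left side is the inverse of [V2'], which [TV] expresses by [V1']. *)
have e1 : B10 *m invmx B11 = T' *m V1' *m T'.
  have -> : invmx B11 = invmx B10 *m (T' *m V1' *m T').
    rewrite B11V; apply: invmx_eq; rewrite mulmxA mulmxK //.
    transitivity (T' *m (T' *m V2' *m T' *m V1') *m T').
      by rewrite !mulmxA T2 mul1mx.
    by rewrite TV mulmx1 T2.
  by rewrite mulKVmx.
have e2 : B11 *m invmx B01 = U2' by rewrite B11U mulmxK.
(* Compatibility turns the first two factors into [U1'], whose inverse is [T *m U2' *m T] by
   [TU]. *)
have e3 : V1' *m (A10 *m invmx A01) *m (T *m U2' *m T) = 1%:M.
  have -> : invmx A01 = invmx A00 *m invmx V1.
    by rewrite A01E invmx_mul.
  rewrite A10E (mulmxA (U1 *m A00)) mulmxK // (mulmxA V1') cp mulmxK //.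
  exact: mulmx1C.
transitivity (invmx A00 *m T *m (B10 *m invmx B11) *m T' *m (A10 *m invmx A01)
    *m T *m (B11 *m invmx B01) *m T' *m A00); first by rewrite !mulmxA.
rewrite e1 e2; set Y := A10 *m _ in e3 *.
transitivity (invmx A00 *m (T *m T' *m (V1' *m Y *m (T *m U2' *m T))
    *m (T *m T')) *m A00); first by rewrite !mulmxA !KT' KT.
by rewrite e3 mulmx1 TT mulmxN mulmx1 mulNmx mulVmx.
Qed.

(** The scalars of the four edges come out of the cross ratio, the two reversed edges contribute
    signs that cancel, and the remaining word is $-1$. *)
Lemma cross_ratio_edges (f f1 f2 f12 : 'M[C]_2) (p p' q q' : C)
  (A00 A10 A01 B10 B01 B11 T T' U1 V1 U1' V1' U2' V2' : 'M[C]_2) :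
  A00 \in unitmx -> V1 \in unitmx -> A10 \in unitmx -> B10 \in unitmx ->
  B01 \in unitmx -> B11 \in unitmx ->
  A10 = U1 *m A00 -> A01 = V1 *m A00 -> B11 = V2' *m B10 -> B11 = U2' *m B01 ->
  V1' *m U1 = U1' *m V1 ->
  T *m U2' *m T *m U1' = 1%:M -> T' *m V2' *m T' *m V1' = 1%:M ->
  T *m T = 1%:M -> T' *m T' = 1%:M -> (T *m T') *m (T *m T') = - 1%:M ->
  q != 0 -> q' != 0 ->
  f1 - f = p *: (invmx A00 *m T *m B10) ->
  f12 - f2 = p' *: (invmx A01 *m T *m B11) ->
  f2 - f = q *: (invmx A00 *m T' *m B01) ->
  f12 - f1 = q' *: (invmx A10 *m T' *m B11) ->
  (f - f1) *m invmx (f1 - f12) *m (f12 - f2) *m invmx (f2 - f)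
  = (- (p * p' / (q * q')))%:M.
Proof.
move=> uA uV1 uA10 uB10 uB01 uB11 A10E A01E B11V B11U cp TU TV T1 T2 TT q0 q'0.
move=> e1 e1' e2 e2'; rewrite e1' e2 -(opprB f1 f) e1 -(opprB f12 f1) e2' -!scaleNr.
rewrite !invmx_scale_involution ?oppr_eq0 // -!scalemxAl -!scalemxAr -!scalemxAl.
rewrite !scalerA.
rewrite (cross_ratio_word uA uV1 uB10 uB01 A10E A01E B11V B11U cp TU TV T1 T2 TT).
rewrite scalerN -scaleNr scalemx1; congr _%:M.
by rewrite invrN; field; rewrite q0 q'0.
Qed.

End MatrixWords.

(** * Quaternions as complex matrices and the gauge matrix *)

Section Mx2.
Variable R : realType.
Local Notation C := R[i].
Implicit Types (X Y : 'M[C]_2).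

Lemma mx2_eqP X Y :
  X = Y <-> [/\ X 0 0 = Y 0 0, X 0 1 = Y 0 1, X 1 0 = Y 1 0 & X 1 1 = Y 1 1].
Proof. by split=> [->//|[h1 h2 h3 h4]]; rewrite (mx2E X) (mx2E Y) h1 h2 h3 h4. Qed.

Lemma mul_mx2 (a b c d a' b' c' d' : C) : mx2 a b c d *m mx2 a' b' c' d' =
  mx2 (a * a' + b * c') (a * b' + b * d') (c * a' + d * c') (c * b' + d * d').
Proof. by apply/mx2_eqP; split; rewrite !mxE big_ord_recl big_ord1 !mxE. Qed.

Lemma add_mx2 (a b c d a' b' c' d' : C) :
  mx2 a b c d + mx2 a' b' c' d' = mx2 (a + a') (b + b') (c + c') (d + d').
Proof. by apply/mx2_eqP; split; rewrite !mxE. Qed.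

Lemma opp_mx2 (a b c d : C) : - mx2 a b c d = mx2 (- a) (- b) (- c) (- d).
Proof. by apply/mx2_eqP; split; rewrite !mxE. Qed.

Lemma scale_mx2 (k a b c d : C) :
  k *: mx2 a b c d = mx2 (k * a) (k * b) (k * c) (k * d).
Proof. by apply/mx2_eqP; split; rewrite !mxE. Qed.

Lemma scalar_mx2 (k : C) : k%:M = mx2 k 0 0 k.
Proof. by apply/mx2_eqP; split; rewrite !mxE. Qed.

Lemma det_mx2 (a b c d : C) : \det (mx2 a b c d) = a * d - b * c.
Proof. by rewrite det2_mx !mxE. Qed.

Definition mx2_simp := (mul_mx2, opp_mx2, add_mx2, scale_mx2, scalar_mx2).

Lemma det1_unit X : \det X = 1 -> X \in unitmx.
Proof. by rewrite unitmxE => ->; rewrite unitr1. Qed.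

Lemma invmx_det1 X : \det X = 1 ->
  invmx X = mx2 (X 1 1) (- X 0 1) (- X 1 0) (X 0 0).
Proof.
rewrite det2_mx => dX; apply: invmx_eq; rewrite {1}(mx2E X) mul_mx2 scalar_mx2 -dX.
by congr mx2; ring.
Qed.

Lemma det_invmx1 X : \det X = 1 -> \det (invmx X) = 1.
Proof. by move=> dX; rewrite det_inv dX invr1. Qed.

(** These are quaternions of any norm: edges of the nets are differences of unit quaternions, and
    [coords] has to be injective on them as well. *)
Definition quaternionic X : Prop :=
  X 0 0 = (X 1 1)^* /\ X 0 1 = - (X 1 0)^*.

Lemma quaternionicE X : quaternionic X ->
  X = mx2 (X 1 1)^* (- (X 1 0)^*) (X 1 0) (X 1 1).
Proof. by case=> <- <-; exact: mx2E. Qed.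

Lemma quaternionicM X Y :
  quaternionic X -> quaternionic Y -> quaternionic (X *m Y).
Proof.
move=> /quaternionicE -> /quaternionicE ->; rewrite mul_mx2.
case: (X 1 0) (X 1 1) (Y 1 0) (Y 1 1) => ? ? [? ?] [? ?] [? ?].
by split; rewrite !mxE; apply: complexP => /=; ring.
Qed.

Lemma quaternionicD X Y :
  quaternionic X -> quaternionic Y -> quaternionic (X + Y).
Proof. by case=> hX kX [hY kY]; split; rewrite !mxE rmorphD /= ?hX ?hY ?kX ?kY ?opprD. Qed.

Lemma quaternionicZ (k : R) X : quaternionic X -> quaternionic (k%:C *: X).
Proof.
by case=> hX kX; split; rewrite !mxE ?hX ?kX; case: (X 1 _) => ? ?;
  apply: complexP => /=; ring.
Qed.

Lemma quaternionicN X : quaternionic X -> quaternionic (- X).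
Proof. by case=> hX kX; split; rewrite !mxE rmorphN /= ?hX ?kX. Qed.

Lemma quaternionic_inv X :
  \det X = 1 -> quaternionic X -> quaternionic (invmx X).
Proof.
move=> dX [hX kX]; rewrite invmx_det1 //; split; rewrite !mxE ?hX ?kX ?conjcK //.
by rewrite rmorphN /= opprK.
Qed.

Lemma SU2_quaternionic X : SU2 X -> quaternionic X.
Proof.
move=> /SU2_coordsK <-; rewrite quatE; split; rewrite !mxE //=.
by apply: complexP => /=; rewrite ?opprK.
Qed.

Lemma quaternionic_coordsK X : quaternionic X -> quat (coords X) = X.
Proof.
move=> qX; rewrite [RHS]quaternionicE // quatE !mxE /=.
by congr mx2; apply: complexP; case: (X 1 _) => ? ? /=; rewrite ?opprK.
Qed.

Lemma coords_inj X Y :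
  quaternionic X -> quaternionic Y -> coords X = coords Y -> X = Y.
Proof. by move=> qX qY /(congr1 (@quat R)); rewrite !quaternionic_coordsK. Qed.

Lemma coordsD X Y : coords (X + Y) = coords X + coords Y.
Proof.
apply/rowP => j; rewrite !mxE.
by case: (X 1 0) (X 1 1) (Y 1 0) (Y 1 1) => ? ? [? ?] [? ?] [? ?];
  case: j => [[|[|[|[|j]]]] hj] //=; rewrite opprD.
Qed.

Lemma coordsZ (k : R) X : coords (k%:C *: X) = k *: coords X.
Proof.
apply/rowP => j; rewrite !mxE.
by case: (X 1 0) (X 1 1) => ? ? [? ?];
  case: j => [[|[|[|[|j]]]] hj] //=; ring.
Qed.

Lemma coordsN X : coords (- X) = - coords X.
Proof. by rewrite -scaleN1r -(rmorphN1 (real_complex R)) coordsZ scaleN1r. Qed.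

Lemma sqnorm_coords X : quaternionic X -> (sqnorm (coords X))%:C = \det X.
Proof.
move=> qX; rewrite [in RHS](quaternionicE qX) det_mx2 /sqnorm /dot.
rewrite !big_ord_recl big_ord0 !mxE /=.
by case: (X 1 0) (X 1 1) => ? ? [? ?] /=; apply: complexP => /=; ring.
Qed.

Lemma qkE : qk R = mx2 (- 'i%C) 0 0 'i%C. Proof. by []. Qed.

(** As [qk] is diagonal, powers act on the entries $-it$ and $it$ separately, and the entrywise real
    and imaginary parts are the cosine and sine series. *)
Lemma expmx_qk (t : R) : expmx (t%:C *: qk R) = mx2 (expi (- t)) 0 0 (expi t).
Proof.
have termE n : (n`!%:R : C)^-1 *: (t%:C *: qk R) ^+ n =
    mx2 (cos_coeff (- t) n +i* sin_coeff (- t) n) 0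
        0 (cos_coeff t n +i* sin_coeff t n).
  have -> : (t%:C *: qk R) ^+ n =
      mx2 (((- t)%:C * 'i%C) ^+ n) 0 0 ((t%:C * 'i%C) ^+ n).
    elim: n => [|n IH]; first by rewrite !expr0 -scalar_mx2.
    rewrite exprS IH qkE scale_mx2 [_ * _]mul_mx2 !exprS rmorphN.
    by congr mx2; ring.
  by rewrite scale_mx2 !mulr0 !expi_term.
have lim0 : limn (series (fun=> 0 : R)) = 0.
  rewrite (_ : series _ = fun=> 0); first exact: lim_cst.
  by apply/funext => n; rewrite /series /= big1.
apply/mx2_eqP; split; rewrite !mxE /expi ?cos.unlock ?sin.unlock; congr Complex.
all: try by rewrite -[RHS]lim0; congr (limn (series _)); apply/funext => n;
   rewrite termE mxE.
all: by congr (limn (series _)); apply/funext => n; rewrite termE mxE.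
Qed.

Lemma Mgauge_diag (g1 g2 : R) : let w := expi ((g2 - g1) / 2) in
  Mgauge g1 g2 = mx2 w 0 0 w^-1.
Proof. by rewrite /= /Mgauge expmx_qk -expiN -!mulNr !opprB. Qed.

End Mx2.

(** * Edge matrices and their symmetry under a reflection *)

Section EdgeMatrix.
Variable R : realType.
Local Notation C := R[i].
Local Notation normc := ComplexField.Normc.normc.
Implicit Types (a l e h : C) (u al : R).

(* [edge_mx a u al l] is the matrix U(l) of the Lax pair; V(l) is of the same
   form, at the spectral parameter [i l]. *)
Definition edge_mx a u al l : 'M[C]_2 :=
  (al^-1)%:C *: mx2 a (- (l * u%:C) - l^-1 * (u^-1)%:C)
                    (l * (u^-1)%:C + l^-1 * u%:C) a^*.

Lemma edge_mxE a u al l : edge_mx a u al l =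
  (al^-1)%:C *: mx2 a (- (l * u%:C) - l^-1 * (u^-1)%:C)
                    (l * (u^-1)%:C + l^-1 * u%:C) a^*.
Proof. by []. Qed.

Lemma Umx_edge_mx a u (alpha : C -> R) l :
  Umx a u alpha l = edge_mx a u (alpha l) l.
Proof. by []. Qed.

Lemma Vmx_edge_mx b v (beta : C -> R) l :
  Vmx b v beta l = edge_mx b v (beta l) ('i%C * l).
Proof. by rewrite /Vmx /edge_mx invfM inv_ii; congr (_ *: mx2 _ _ _ _); ring. Qed.

Lemma mulcJ_normc a : a * a^* = (normc a ^+ 2)%:C.
Proof. by rewrite -sqr_normc rmorphXn. Qed.

Lemma det_edge_mx a u al l : `|l| = 1 -> u != 0 -> \det (edge_mx a u al l) =
  (al ^- 2 * (normc a ^+ 2 + u ^+ 2 + u ^- 2 + 2 * complex.Re (l ^+ 2)))%:C.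
Proof.
move=> hl u0; have l0 := unit_circle_neq0 hl.
have uC0 : u%:C != 0 by rewrite fmorph_eq0.
rewrite /edge_mx scale_mx2 det_mx2 -exprVn; move: (al^-1) => g.
rewrite rmorphM !rmorphD /= -unit_circle_sqr_add // -mulcJ_normc.
rewrite !rmorphXn !fmorphV !rmorphXn /=.
by field; rewrite l0 uC0.
Qed.

Lemma edge_mx_factor a u al l : `|l| = 1 -> u != 0 ->
  \det (edge_mx a u al l) = 1 -> al != 0 /\
  al ^+ 2 = normc a ^+ 2 + u ^+ 2 + u ^- 2 + 2 * complex.Re (l ^+ 2).
Proof.
move=> hl u0; rewrite det_edge_mx //; set n := (_ + 2 * _).
rewrite -[1]/(1%:C) => /complexI E.
(* If [al] were 0, the convention that 0 has inverse 0 would make the determinant vanish. *)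
have al0 : al != 0.
  apply: contra_eq_neq E => ->.
  by rewrite expr0n invr0 mul0r eq_sym oner_eq0.
split=> //; rewrite -[LHS]mulr1 -E mulrA mulfV ?mul1r //.
by rewrite expf_neq0.
Qed.

Definition reflection e : 'M[C]_2 := mx2 0 e^-1 e 0.

Section Reflection.
Variables (l e h : C).
Hypothesis l_neq0 : l != 0.
Hypothesis eh : e ^+ 2 = h.
Hypothesis h1 : h = 1 \/ h = -1.

Let hh : h * h = 1.
Proof. by case: h1 => ->; rewrite ?mulr1 ?mulrNN ?mulr1. Qed.

Let e_neq0 : e != 0.
Proof.
apply: contra_eq_neq hh => e0.
by rewrite -eh e0 expr0n mul0r eq_sym oner_eq0.
Qed.

Let invh : h^-1 = h.
Proof. by case: h1 => ->; rewrite ?invrN invr1. Qed.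

Let inve : e^-1 = h * e.
Proof.
by apply: (mulfI e_neq0); rewrite mulfV // mulrCA -expr2 eh hh.
Qed.

Lemma reflectionK : reflection e *m reflection e = 1%:M.
Proof.
rewrite /reflection mul_mx2 scalar_mx2 !mul0r !mulr0 !addr0 !add0r.
by rewrite mulVf // mulfV.
Qed.

(** The second spectral parameter is [h / l]. Conjugation by the reflection swaps the diagonal
    entries, and swaps the others with a factor [h]; this turns the matrix at [h / l] into the
    adjugate of the one at [l]. *)
Lemma edge_mx_reflection a u al : u != 0 ->
  reflection e *m edge_mx a u al (h / l) *m reflection e *m edge_mx a u al l
  = (\det (edge_mx a u al l))%:M.
Proof.
move=> u0; have uC0 : u%:C != 0 by rewrite fmorph_eq0.
have ee : e * e = h by rewrite -expr2.
have e1 : e * e^-1 = 1 by rewrite mulfV.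
have ei : e^-1 * e^-1 = h by rewrite -invfM ee invh.
have conj_refl p q r s : reflection e *m mx2 p q r s *m reflection e
    = mx2 s (h * r) (h * q) p.
  rewrite /reflection !mul_mx2.
  by congr mx2; [|rewrite -ei|rewrite -ee|]; field.
rewrite /edge_mx !scale_mx2 conj_refl mul_mx2 det_mx2.
rewrite scalar_mx2 invfM invrK invh !fmorphV /=; move: (al%:C^-1) => g.
by case: h1 => ->; congr mx2; field; rewrite l_neq0 uC0.
Qed.

Let M : 'M[C]_2 := mx2 (e / l) 0 0 (l / e).

(** The diagonal cancels, since [M] is diagonal and both edge matrices share [a] and [al]. Off the
    diagonal the terms in $u^{-1}$ cancel, and the terms in $u$ leave $l^2 - l^{-2}$. *)
Lemma edge_mx_gauge a u al : u != 0 ->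
  M *m edge_mx a u al (h / l) - edge_mx a u al l *m M
  = ((u / al)%:C * (l ^+ 2 - l ^- 2)) *: reflection e.
Proof.
move=> u0; have uC0 : u%:C != 0 by rewrite fmorph_eq0.
rewrite /edge_mx /M /reflection !mx2_simp rmorphM /= !fmorphV /=.
rewrite invfM invrK inve invh; move: (al%:C^-1) => g.
by case: h1 => ->; congr mx2; field; rewrite l_neq0 ?uC0.
Qed.

(** The two entries of [qk] have opposite signs, so the off-diagonal terms that are subtracted in
    [edge_mx_gauge] are added here. *)
Lemma edge_mx_normal_gauge a u al : u != 0 ->
  qk R *m M *m edge_mx a u al (h / l) - edge_mx a u al l *m (qk R *m M)
  = ((u / al)%:C * (l ^+ 2 + l ^- 2 + 2 * (u ^- 2)%:C) * 'i%C) *: reflection e.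
Proof.
move=> u0; have uC0 : u%:C != 0 by rewrite fmorph_eq0.
rewrite /edge_mx /M /reflection qkE !mx2_simp rmorphM /= !fmorphV !rmorphXn /=.
rewrite invfM invrK inve invh; move: (al%:C^-1) => g.
by case: h1 => ->; congr mx2; field; rewrite l_neq0 ?uC0.
Qed.

End Reflection.

(** The values $1$, $-1$ and $i$ of $l^2$ give enough linear equations. *)
Lemma laurent2_eq0 (c2 c0 c1 : C) :
  (forall l, `|l| = 1 -> c2 * l ^+ 2 + c0 + c1 * l ^- 2 = 0) -> c2 = 0.
Proof.
move=> h.
have ev t : c2 * expi (2 * t) + c0 + c1 * (expi (2 * t))^-1 = 0.
  by rewrite -expi_sqr; apply/h/norm_expi.
have e1 : c2 + c0 + c1 = 0 by have := ev 0; rewrite mulr0 expi0 invr1 !mulr1.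
have epi : expi pi = -1 :> C.
  by apply: complexP; rewrite /= ?cospi ?sinpi ?oppr0.
have e2 : - c2 + c0 - c1 = 0.
  have := ev (pi / 2); rewrite [2 * _]mulrC divfK ?pnatr_eq0 // epi invrN invr1.
  by rewrite !mulrN1.
have ei : expi (pi / 2) = 'i%C :> C.
  by apply: complexP; rewrite /= ?cos_pihalf ?sin_pihalf.
have e3 : c2 * 'i%C + c0 - c1 * 'i%C = 0.
  have := ev (pi / 2 / 2); rewrite [2 * _]mulrC divfK ?pnatr_eq0 // ei inv_ii.
  by rewrite mulrN.
have c00 : c0 = 0.
  have : 2 * c0 = 0 by rewrite -[RHS]addr0 -{1}e1 -e2; ring.
  by move/eqP; rewrite mulf_eq0 pnatr_eq0 => /eqP.
have c12 : c1 = - c2 by apply/eqP; rewrite -addr_eq0 addrC -e1 c00 addr0.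
move: e3; rewrite c12 c00 addr0 mulNr opprK -mulrDr => /eqP.
by rewrite mulf_eq0 -mulr2n mulrn_eq0 /= (negPf (ii_neq0 R)) orbF => /eqP.
Qed.

(** Cleared of [al] and [be], the upper left entry of the compatibility condition is a Laurent
    polynomial in $l$, whose coefficient at $l^2$ is $i (u'/v - v'/u)$. *)
Lemma compat_edge_mx a a' b b' u u' v v' (al be : C -> R) : u != 0 -> u' != 0 -> v != 0 ->
  v' != 0 -> (forall l : C, `|l| = 1 -> al l != 0 /\ be l != 0) ->
  (forall l, `|l| = 1 ->
    edge_mx b' v' (be l) ('i%C * l) *m edge_mx a u (al l) l
    = edge_mx a' u' (al l) l *m edge_mx b v (be l) ('i%C * l)) ->
  u * u' = v * v'.
Proof.
move=> u0 u'0 v0 v'0 ab0 h.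
have E : 'i%C * (u'%:C / v%:C - v'%:C / u%:C) = 0.
  apply: (@laurent2_eq0 _ (b' * a - a' * b - 'i%C * (v'%:C * u%:C - u%:C^-1 / v'%:C)
     + 'i%C * (u'%:C^-1 / v%:C - u'%:C * v%:C))
     ('i%C * (u%:C / v'%:C - v%:C / u'%:C))) => l hl.
  have l0 := unit_circle_neq0 hl.
  have [al0 be0] := ab0 l hl.
  have /mx2_eqP[+ _ _ _] := h l hl; rewrite /edge_mx !mx2_simp !mxE /=.
  rewrite invfM inv_ii !fmorphV /= => e.
  have alC0 : (al l)%:C != 0 by rewrite fmorph_eq0.
  have beC0 : (be l)%:C != 0 by rewrite fmorph_eq0.
  move: e => /(congr1 (fun x => x * ((al l)%:C * (be l)%:C))) /eqP.
  rewrite -subr_eq0 => /eqP e; rewrite -[RHS]e.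
  have ucs : [&& u%:C != 0, u'%:C != 0, v%:C != 0 & v'%:C != 0].
    by rewrite !fmorph_eq0 u0 u'0 v0.
  move: ucs => /and4P[uC u'C vC v'C].
  by field; rewrite l0 uC u'C vC v'C alC0 beC0.
move/eqP: E; rewrite mulf_eq0 (negPf (ii_neq0 R)) /= subr_eq0 -!fmorph_div /=.
move=> /eqP /complexI E.
have -> : u * u' = u * v * (u' / v) by field.
by rewrite E; field.
Qed.

End EdgeMatrix.

(** * Continuity along loops and the sign of the normalizing factors *)

Section Loops.
Variable R : realType.
Local Notation C := R[i].
Implicit Types f g : R -> C.

Lemma continuous_same_sign (f : R -> R) :
  continuous f -> (forall t, f t != 0) -> forall t t', 0 < f t * f t'.
Proof.
move=> cf f0 t t'; wlog tt' : t t' / t <= t' => [h|].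
  by have [/h//|/ltW /h] := leP t t'; rewrite mulrC.
rewrite ltNge; apply/negP => ff.
have [||c _ fc] := @IVT R f t t' 0 tt'.
- exact: continuous_subspaceT.
- have := f0 t; have := f0 t'; rewrite ge_min le_max.
  by case: ltgtP ff => // h1; case: ltgtP => // h2; nra.
by move: (f0 c); rewrite fc eqxx.
Qed.

Definition loop_continuous f : Prop :=
  continuous (fun t => complex.Re (f t)) /\ continuous (fun t => complex.Im (f t)).

Lemma loop_continuousM f g : loop_continuous f -> loop_continuous g ->
  loop_continuous (fun t => f t * g t).
Proof.
move=> [f1 f2] [g1 g2]; split.
- rewrite (_ : (fun t => _) = (fun t => complex.Re (f t) * complex.Re (g t)
      - complex.Im (f t) * complex.Im (g t))); last first.
    by apply/funext => t; case: (f t) (g t) => ? ? [].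
  move=> t; apply: cvgB; apply: cvgM;
    by [apply: f1|apply: f2|apply: g1|apply: g2].
- rewrite (_ : (fun t => _) = (fun t => complex.Re (f t) * complex.Im (g t)
      + complex.Im (f t) * complex.Re (g t))); last first.
    by apply/funext => t; case: (f t) (g t) => ? ? [].
  move=> t; apply: cvgD; apply: cvgM;
    by [apply: f1|apply: f2|apply: g1|apply: g2].
Qed.

Lemma loop_continuousD f g : loop_continuous f -> loop_continuous g ->
  loop_continuous (fun t => f t + g t).
Proof.
move=> [f1 f2] [g1 g2]; split.
- rewrite (_ : (fun t => _) = (fun t => complex.Re (f t) + complex.Re (g t))).
    by move=> t; apply: cvgD; [apply: f1|apply: g1].
  by apply/funext => t; case: (f t) (g t) => ? ? [].
- rewrite (_ : (fun t => _) = (fun t => complex.Im (f t) + complex.Im (g t))).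
    by move=> t; apply: cvgD; [apply: f2|apply: g2].
  by apply/funext => t; case: (f t) (g t) => ? ? [].
Qed.

Lemma loop_continuous_cst (c : C) : loop_continuous (fun=> c).
Proof. by split=> t; exact: cst_continuous. Qed.

Lemma loop_continuous_conj f : loop_continuous f -> loop_continuous (fun t => conjc (f t)).
Proof.
move=> [f1 f2]; split.
  rewrite (_ : (fun t => _) = (fun t => complex.Re (f t))) //.
  by apply/funext => t; case: (f t).
rewrite (_ : (fun t => _) = (fun t => - complex.Im (f t))).
  by move=> t; apply: cvgN; apply: f2.
by apply/funext => t; case: (f t).
Qed.

Lemma loop_continuous_expi : loop_continuous (@expi R).
Proof. by split; [exact: continuous_cos|exact: continuous_sin]. Qed.

(** The entries of $E = Q P^{-1}$ are continuous because [P] has determinant 1. Multiplied by [al],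
    the equation $\det E = 1$ reads $al = E_{00} \bar a + E_{10} z$ with $z = l u + l^{-1} u^{-1}$,
    which involves no choice of a root. *)
Lemma edge_mx_continuous (a : C) (u : R) (al : R -> R) (c : C)
    (P Q : R -> 'M[C]_2) : `|c| = 1 -> u != 0 ->
  (forall t, \det (P t) = 1) ->
  (forall i j, loop_continuous (fun t => P t i j)) ->
  (forall i j, loop_continuous (fun t => Q t i j)) ->
  (forall t, \det (edge_mx a u (al t) (c * expi t)) = 1) ->
  (forall t, Q t = edge_mx a u (al t) (c * expi t) *m P t) -> continuous al.
Proof.
move=> c1 u0 dP cP cQ dE QE.
have l1 t : `|c * expi t| = 1 by rewrite normrM c1 norm_expi mulr1.
(* The inverse of the unit number is written as its conjugate, so that continuity is immediate. *)
pose z t := conjc (c * expi t) * (u^-1)%:C + c * expi t * u%:C.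
pose E00 t := Q t 0 0 * P t 1 1 + (-1) * (Q t 0 1 * P t 1 0).
pose E10 t := Q t 1 0 * P t 1 1 + (-1) * (Q t 1 1 * P t 1 0).
have alE t : (al t)%:C = E00 t * conjc a + E10 t * z t.
  have [al0 al2] := edge_mx_factor (l1 t) u0 (dE t).
  have [alC0 uC0] : (al t)%:C != 0 /\ u%:C != 0 by rewrite !fmorph_eq0.
  have l0 := unit_circle_neq0 (l1 t).
  have EE : edge_mx a u (al t) (c * expi t) = Q t *m invmx (P t).
    by rewrite QE mulmxK // det1_unit.
  have [e00 _ e10 _] := (mx2_eqP _ _).1 EE.
  have -> : E00 t = (al t)%:C^-1 * a.
    move: e00; rewrite invmx_det1 // (mx2E (Q t)) mul_mx2 !mxE fmorphV /= => ->.
    by rewrite /E00; ring.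
  have -> : E10 t = (al t)%:C^-1 * (c * expi t * u%:C^-1 + (c * expi t)^-1 * u%:C).
    move: e10; rewrite invmx_det1 // (mx2E (Q t)) mul_mx2 !mxE !fmorphV /= => ->.
    by rewrite /E10; ring.
  rewrite /z -(unit_circle_inv (l1 t)) fmorphV /=.
  move: al2 => /(congr1 (real_complex R)).
  rewrite !rmorphD /= -unit_circle_sqr_add // -mulcJ_normc.
  rewrite !rmorphXn !fmorphV !rmorphXn /= => al2.
  apply: (mulfI alC0); rewrite -expr2 al2; field.
  by rewrite uC0 alC0 (unit_circle_neq0 c1) expi_neq0.
have cl : loop_continuous (fun t => c * expi t).
  by apply: loop_continuousM; [exact: loop_continuous_cst|exact: loop_continuous_expi].
suff [] : loop_continuous (fun t => (al t)%:C) by [].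
have cst := loop_continuous_cst.
have cE f g f' g' : loop_continuous f -> loop_continuous g ->
    loop_continuous f' -> loop_continuous g' ->
    loop_continuous (fun t => f t * g t + (-1) * (f' t * g' t)).
  move=> cf cg cf' cg'; apply: loop_continuousD; first exact: loop_continuousM.
  by apply: loop_continuousM => //; exact: loop_continuousM.
rewrite (funext alE); apply: loop_continuousD; apply: loop_continuousM => //.
- exact: cE.
- exact: cE.
- apply: loop_continuousD; apply: loop_continuousM => //.
  exact: loop_continuous_conj.
Qed.

(** The determinant makes the squares equal, and a continuous function without zeros keeps its
    sign. *)
Lemma edge_mx_factor_eq (a : C) (u : R) (al : R -> R) (c : C)
    (P Q : R -> 'M[C]_2) : `|c| = 1 -> u != 0 ->
  (forall t, \det (P t) = 1) ->
  (forall i j, loop_continuous (fun t => P t i j)) ->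
  (forall i j, loop_continuous (fun t => Q t i j)) ->
  (forall t, \det (edge_mx a u (al t) (c * expi t)) = 1) ->
  (forall t, Q t = edge_mx a u (al t) (c * expi t) *m P t) ->
  forall t t', complex.Re ((c * expi t) ^+ 2) = complex.Re ((c * expi t') ^+ 2) ->
  al t = al t'.
Proof.
move=> c1 u0 dP cP cQ dE QE t t' tt'.
have cal := edge_mx_continuous c1 u0 dP cP cQ dE QE.
have l1 x : `|c * expi x| = 1 by rewrite normrM c1 norm_expi mulr1.
have al0 x : al x != 0 by have [] := edge_mx_factor (l1 x) u0 (dE x).
have pos := continuous_same_sign cal al0 t t'.
have [_ E] := edge_mx_factor (l1 t) u0 (dE t).
have [_ E'] := edge_mx_factor (l1 t') u0 (dE t').
have /eqP : al t ^+ 2 = al t' ^+ 2 by rewrite E E' tt'.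
rewrite eqf_sqr => /orP[/eqP//|/eqP h].
by move: pos; rewrite h mulNr -expr2 oppr_gt0 ltNge sqr_ge0.
Qed.

End Loops.

(** * Edges of [F] and [N] along one lattice edge *)

Section NetEdges.
Variable R : realType.
Local Notation C := R[i].
Variables (l e h : C) (a : C) (u al : R) (A1 A2 B1 B2 : 'M[C]_2).
Hypothesis l_unit : `|l| = 1.
Hypothesis eh : e ^+ 2 = h.
Hypothesis h1 : h = 1 \/ h = -1.
Hypothesis u_neq0 : u != 0.
Hypothesis A1_unit : A1 \in unitmx.
Hypothesis dE : \det (edge_mx a u al l) = 1.
Hypothesis B1E : B1 = edge_mx a u al l *m A1.
Hypothesis B2E : B2 = edge_mx a u al (h / l) *m A2.

Let M : 'M[C]_2 := mx2 (e / l) 0 0 (l / e).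

Let l_neq0 : l != 0. Proof. exact: unit_circle_neq0. Qed.

Lemma edge_mx_inv : invmx (edge_mx a u al l)
  = reflection e *m edge_mx a u al (h / l) *m reflection e.
Proof.
by apply: invmx_eq; apply: mulmx1C; rewrite (edge_mx_reflection l_neq0 eh h1) ?dE.
Qed.

(** Between the frames stands the inverse edge matrix times a multiple of the reflection. By
    [edge_mx_inv] this is the reflection times the matrix at [h / l], which carries [A2] to [B2]. *)
Lemma net_edge_F : invmx B1 *m M *m B2 - invmx A1 *m M *m A2
  = ((u / al)%:C * (l ^+ 2 - l ^- 2)) *: (invmx A1 *m reflection e *m B2).
Proof.
rewrite B1E B2E (net_edge _ _ _ A1_unit (det1_unit dE)) (edge_mx_gauge l_neq0 eh h1) //.
rewrite edge_mx_inv -scalemxAr -scalemxAl; congr (_ *: _).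
rewrite -!mulmxA; do 3 congr (_ *m _).
by rewrite mulmxA (reflectionK eh h1) mul1mx.
Qed.

(** Both gauged differences are multiples of the same reflection. Their quotient is real because
    $l^2 + l^{-2}$ is real and $l^2 - l^{-2}$ is imaginary on the unit circle. *)
Lemma net_edge_N : complex.Im (l ^+ 2) != 0 ->
  - (invmx B1 *m qk R *m M *m B2) - - (invmx A1 *m qk R *m M *m A2)
  = (- ((complex.Re (l ^+ 2) + u ^- 2) / complex.Im (l ^+ 2)))%:C
    *: (invmx B1 *m M *m B2 - invmx A1 *m M *m A2).
Proof.
move=> s0; rewrite B1E B2E (net_edge_normal _ _ _ _ A1_unit (det1_unit dE)).
rewrite (net_edge _ _ _ A1_unit (det1_unit dE)).
rewrite (edge_mx_normal_gauge l_neq0 eh h1) // (edge_mx_gauge l_neq0 eh h1) //.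
rewrite -scaleNr -!scalemxAr -!scalemxAl scalerA; congr (_ *: _).
rewrite unit_circle_sqr_add // unit_circle_sqr_sub //.
move: (u / al)%:C (u ^- 2) => k x; rewrite -[2]/(2%:R) -(rmorph_nat (real_complex R)).
have sC0 : (complex.Im (l ^+ 2))%:C != 0 by rewrite fmorph_eq0.
rewrite !(rmorphN, rmorphM, rmorphD) /= !fmorphV /=.
by field.
Qed.

Lemma det_net_edge_F : \det A1 = 1 -> \det B2 = 1 ->
  \det (invmx B1 *m M *m B2 - invmx A1 *m M *m A2)
  = (4 * u ^+ 2 * complex.Im (l ^+ 2) ^+ 2 / al ^+ 2)%:C.
Proof.
move=> dA dB; rewrite net_edge_F detZ !det_mulmx det_invmx1 // dB mulr1 mul1r.
rewrite /reflection det_mx2 mul0r sub0r mulVf; last first.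
  apply/eqP => e0; case: h1; rewrite -eh e0 expr0n /= => /eqP.
    by rewrite eq_sym oner_eq0.
  by rewrite eq_sym oppr_eq0 oner_eq0.
have -> : l ^+ 2 - l ^- 2 = (2 * complex.Im (l ^+ 2))%:C * 'i%C.
  exact: unit_circle_sqr_sub.
rewrite mulrA exprMn sqr_i !mulrN1 opprK -rmorphM -rmorphXn /=.
congr (_%:C); rewrite exprMn exprMn exprVn; ring.
Qed.

End NetEdges.

Lemma cross_ratio_quat (R : realType) (F : int -> int -> 'rV[R]_4)
  (X : int -> int -> 'M[R[i]]_2) m n : (forall m n, quat (F m n) = X m n) ->
  cross_ratio F m n = (X m n - X (m + 1) n)
    *m invmx (X (m + 1) n - X (m + 1) (n + 1))
    *m (X (m + 1) (n + 1) - X m (n + 1)) *m invmx (X m (n + 1) - X m n).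
Proof. by move=> FX; rewrite /cross_ratio !FX. Qed.

Opaque edge_mx.

(** * The nets of a frame: sphere, orthogonality and Lax coefficients *)

Section FrameNets.
Variable R : realType.
Local Notation C := R[i].
Variables (a b : int -> int -> C) (u v : int -> int -> R).
Variables (alpha beta : int -> int -> C -> R) (Phi : int -> int -> C -> 'M[C]_2).
Variables g1 g2 : R.
Hypothesis hlax : lax_pair a b u v alpha beta.
Hypothesis hframe : frame a b u v alpha beta Phi.

Local Notation l1 := (expi g1).
Local Notation l2 := (expi g2).
Local Notation F := (netF Phi g1 g2).
Local Notation N := (netN Phi g1 g2).
Local Notation c := (complex.Re (l1 ^+ 2)).
Local Notation s := (complex.Im (l1 ^+ 2)).

Let M := Mgauge g1 g2.
Let w : C := expi ((g2 - g1) / 2).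

Definition netF_mx m n : 'M[C]_2 := invmx (Phi m n l1) *m M *m Phi m n l2.
Definition netN_mx m n : 'M[C]_2 :=
  - (invmx (Phi m n l1) *m qk R *m M *m Phi m n l2).

Let n1 : `|l1| = 1. Proof. exact: norm_expi. Qed.
Let n2 : `|l2| = 1. Proof. exact: norm_expi. Qed.
Let in1 : `|'i%C * l1| = 1.
Proof. by rewrite normrM norm_ii n1 mulr1. Qed.
Let l10 : l1 != 0. Proof. exact: expi_neq0. Qed.
Let w0 : w != 0. Proof. exact: expi_neq0. Qed.
Let u0 m n : u m n != 0. Proof. by rewrite gt_eqF // (lax_u_gt0 hlax). Qed.
Let v0 m n : v m n != 0. Proof. by rewrite gt_eqF // (lax_v_gt0 hlax). Qed.

Let ME : M = mx2 w 0 0 w^-1. Proof. exact: Mgauge_diag. Qed.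

Let l2E : l2 = l1 * w ^+ 2.
Proof. by rewrite expi_sqr -expiD mulrC divfK ?pnatr_eq0 // addrC subrK. Qed.

Let dPhi m n l : `|l| = 1 -> \det (Phi m n l) = 1.
Proof. by move=> hl; have [] := frame_SU2 hframe m n hl. Qed.

Let uPhi m n l : `|l| = 1 -> Phi m n l \in unitmx.
Proof. by move=> hl; rewrite det1_unit ?dPhi. Qed.

Let qPhi m n l : `|l| = 1 -> quaternionic (Phi m n l).
Proof. by move=> hl; apply/SU2_quaternionic/(frame_SU2 hframe). Qed.

Let PhiU m n l : `|l| = 1 ->
  Phi (m + 1) n l = edge_mx (a m n) (u m n) (alpha m n l) l *m Phi m n l.
Proof. by move=> hl; rewrite -Umx_edge_mx; exact: (frame_U hframe m n hl). Qed.

Let PhiV m n l : `|l| = 1 ->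
  Phi m (n + 1) l = edge_mx (b m n) (v m n) (beta m n l) ('i%C * l) *m Phi m n l.
Proof. by move=> hl; rewrite -Vmx_edge_mx; exact: (frame_V hframe m n hl). Qed.

Let dU m n l : `|l| = 1 ->
  \det (edge_mx (a m n) (u m n) (alpha m n l) l) = 1.
Proof. by move=> hl; rewrite -Umx_edge_mx; exact: (lax_detU hlax m n hl). Qed.

Let dV m n l : `|l| = 1 ->
  \det (edge_mx (b m n) (v m n) (beta m n l) ('i%C * l)) = 1.
Proof. by move=> hl; rewrite -Vmx_edge_mx; exact: (lax_detV hlax m n hl). Qed.

Let qM : quaternionic M.
Proof.
rewrite ME /w -expiN; split; rewrite !mxE.
  by apply: complexP; rewrite /= ?cosN ?sinN ?opprK.
by apply: complexP; rewrite /= !oppr0.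
Qed.

Let dM : \det M = 1.
Proof. by rewrite ME det_mx2 mulfV // mulr0 subr0. Qed.

Let qqk : quaternionic (qk R).
Proof. by split; rewrite !mxE //=; apply: complexP; rewrite /= ?oppr0. Qed.

Let qPhiV m n : quaternionic (invmx (Phi m n l1)).
Proof. by apply: quaternionic_inv; [apply: dPhi|apply: qPhi]. Qed.

Lemma quaternionic_netF m n : quaternionic (netF_mx m n).
Proof.
by apply: quaternionicM; [apply: quaternionicM; [exact: qPhiV|]|exact: qPhi].
Qed.

Lemma quaternionic_netN m n : quaternionic (netN_mx m n).
Proof.
apply: quaternionicN; apply: quaternionicM; last exact: qPhi.
by apply: quaternionicM => //; apply: quaternionicM.
Qed.

Lemma netF_sphere m n : sqnorm (F m n) = 1.
Proof.
apply: (@complexI R); rewrite (sqnorm_coords (quaternionic_netF m n)).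
by rewrite /netF_mx !det_mulmx det_invmx1 ?dPhi // dM !mulr1.
Qed.

Lemma netN_sphere m n : sqnorm (N m n) = 1.
Proof.
apply: (@complexI R); rewrite (sqnorm_coords (quaternionic_netN m n)).
rewrite /netN_mx -scaleN1r detZ sqrrN expr1n mul1r.
rewrite !det_mulmx det_invmx1 ?dPhi // dM !mulr1 mul1r qkE det_mx2.
by rewrite mulNr mul_ii opprK mulr0 subr0.
Qed.

(* [F + N] is the image of [1 - k], which has squared norm 2, under the
   isometry that maps 1 to [F]. *)
Lemma netF_netN_orthogonal m n : dot (F m n) (N m n) = 0.
Proof.
have h : sqnorm (F m n + N m n) = 2.
  have -> : F m n + N m n = coords (netF_mx m n + netN_mx m n) by rewrite coordsD.
  apply: (@complexI R); rewrite sqnorm_coords; last first.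
    by apply: quaternionicD; [exact: quaternionic_netF|exact: quaternionic_netN].
  have -> : netF_mx m n + netN_mx m n
      = invmx (Phi m n l1) *m (1%:M - qk R) *m M *m Phi m n l2.
    by rewrite mulmxBr mulmx1 !mulmxBl.
  rewrite !det_mulmx det_invmx1 ?dPhi // dM !mulr1 mul1r qkE !mx2_simp det_mx2.
  by apply: complexP => /=; ring.
move: h; rewrite sqnormD netF_sphere netN_sphere => h.
by apply: (@mulfI _ 2); rewrite ?pnatr_eq0 // mulr0; lra.
Qed.

Lemma edge1_netF m n :
  edge1 F m n = coords (netF_mx (m + 1) n - netF_mx m n).
Proof. by rewrite coordsD coordsN. Qed.

Lemma edge2_netF m n :
  edge2 F m n = coords (netF_mx m (n + 1) - netF_mx m n).
Proof. by rewrite coordsD coordsN. Qed.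

Lemma edge1_netN m n :
  edge1 N m n = coords (netN_mx (m + 1) n - netN_mx m n).
Proof. by rewrite coordsD coordsN. Qed.

Lemma edge2_netN m n :
  edge2 N m n = coords (netN_mx m (n + 1) - netN_mx m n).
Proof. by rewrite coordsD coordsN. Qed.

Lemma lax_factors m n l : `|l| = 1 -> [/\ alpha m n l != 0, beta m n l != 0,
  alpha m n l ^+ 2 = ComplexField.Normc.normc (a m n) ^+ 2 + u m n ^+ 2
    + u m n ^- 2 + 2 * complex.Re (l ^+ 2) &
  beta m n l ^+ 2 = ComplexField.Normc.normc (b m n) ^+ 2 + v m n ^+ 2
    + v m n ^- 2 - 2 * complex.Re (l ^+ 2)].
Proof.
move=> hl; have il : `|'i%C * l| = 1 by rewrite normrM norm_ii hl mulr1.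
have [al0 al2] := edge_mx_factor hl (u0 m n) (dU m n hl).
have [be0 be2] := edge_mx_factor il (v0 m n) (dV m n hl).
split=> //; rewrite be2 exprMn sqr_i mulN1r.
by case: (l ^+ 2) => x y /=; rewrite mulrN.
Qed.

Lemma lax_uv m n : u m n * u m (n + 1) = v m n * v (m + 1) n.
Proof.
apply: (@compat_edge_mx R (a m n) (a m (n + 1)) (b m n) (b (m + 1) n) _ _ _ _
   (alpha m n) (beta m n)); try exact: u0; try exact: v0.
  by move=> l hl; have [] := lax_factors m n hl.
move=> l hl; have := lax_compat hlax m n hl.
rewrite !Vmx_edge_mx !Umx_edge_mx (lax_alpha hlax m n hl) (lax_beta hlax m n hl).
exact.
Qed.

(** * Opposite spectral parameters *)

Section Opposite.
Hypothesis opp : l2 = l1^-1 \/ l2 = - l1^-1.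
Hypothesis s_neq0 : s != 0.

(** The square of [e] is $h = l_1 l_2 = \pm 1$. For edges in the second direction [l1], [e], [h] are
    replaced by $i l_1$, $i e$, $-h$, which leaves [M] unchanged. *)
Let e : C := locked (l1 * w).
Let h : C := locked (l1 * l2).

Let eE : e = l1 * w. Proof. by rewrite /e -lock. Qed.
Let hE : h = l1 * l2. Proof. by rewrite /h -lock. Qed.

Let eh : e ^+ 2 = h. Proof. by rewrite hE l2E eE; ring. Qed.

Let h1 : h = 1 \/ h = -1.
Proof. by rewrite hE; case: opp => ->; rewrite ?mulrN mulfV //; [left|right]. Qed.

Let e0 : e != 0. Proof. by rewrite eE mulf_neq0. Qed.

Let l2h : l2 = h / l1. Proof. by rewrite hE mulrAC mulfV ?mul1r. Qed.

Let Me : M = mx2 (e / l1) 0 0 (l1 / e).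
Proof. by rewrite ME eE; congr mx2; field; rewrite ?l10 ?w0. Qed.

Let ieh : ('i%C * e) ^+ 2 = - h.
Proof. by rewrite exprMn sqr_i eh mulN1r. Qed.

Let ih1 : - h = 1 \/ - h = -1.
Proof. by case: h1 => ->; rewrite ?opprK; [right|left]. Qed.

Let il2h : 'i%C * l2 = - h / ('i%C * l1).
Proof. by rewrite invfM inv_ii l2h; field. Qed.

Let iMe : M = mx2 (('i%C * e) / ('i%C * l1)) 0 0 (('i%C * l1) / ('i%C * e)).
Proof. by rewrite Me; congr mx2; field; rewrite ?l10 ?e0 ii_neq0. Qed.

Let l2sqr : l2 ^+ 2 = l1 ^- 2.
Proof.
rewrite l2h exprMn exprVn; have -> : h ^+ 2 = 1 by case: h1 => ->; rewrite ?sqrrN expr1n.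
by rewrite mul1r.
Qed.

Let conj_sqr : l1 ^- 2 = conjc (l1 ^+ 2).
Proof. by rewrite -exprVn unit_circle_inv // -rmorphXn. Qed.

Let Re_l2 : complex.Re (l2 ^+ 2) = c.
Proof. by rewrite l2sqr conj_sqr; case: (l1 ^+ 2). Qed.

Let Im_l2 : complex.Im (l2 ^+ 2) = - s.
Proof. by rewrite l2sqr conj_sqr; case: (l1 ^+ 2). Qed.

Let Re_il (l : C) : complex.Re (('i%C * l) ^+ 2) = - complex.Re (l ^+ 2).
Proof. by rewrite exprMn sqr_i mulN1r; case: (l ^+ 2). Qed.

Let Im_il (l : C) : complex.Im (('i%C * l) ^+ 2) = - complex.Im (l ^+ 2).
Proof. by rewrite exprMn sqr_i mulN1r; case: (l ^+ 2). Qed.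

(** The squares of [l1] and [l2] are conjugate, hence have the same real part. *)
Lemma alpha_opposite m n : alpha m n l2 = alpha m n l1.
Proof.
pose al t := alpha m n (expi t).
apply: (@edge_mx_factor_eq R (a m n) (u m n) al 1 (fun t => Phi m n (expi t))
  (fun t => Phi (m + 1) n (expi t))); rewrite ?normr1 ?mul1r //.
- by move=> t; apply/dPhi/norm_expi.
- by move=> i j; apply: (frame_loop hframe).
- by move=> i j; apply: (frame_loop hframe).
- by move=> t; rewrite mul1r dU // norm_expi.
- by move=> t; rewrite mul1r PhiU // norm_expi.
Qed.

Lemma beta_opposite m n : beta m n l2 = beta m n l1.
Proof.
pose be t := beta m n (expi t).
apply: (@edge_mx_factor_eq R (b m n) (v m n) be 'i%C (fun t => Phi m n (expi t))
  (fun t => Phi m (n + 1) (expi t))); rewrite ?norm_ii //.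
- by move=> t; apply/dPhi/norm_expi.
- by move=> i j; apply: (frame_loop hframe).
- by move=> i j; apply: (frame_loop hframe).
- by move=> t; rewrite dV // norm_expi.
- by move=> t; rewrite PhiV // norm_expi.
- by rewrite !Re_il Re_l2.
Qed.

Let U2E m n : Phi (m + 1) n l2
  = edge_mx (a m n) (u m n) (alpha m n l1) (h / l1) *m Phi m n l2.
Proof. by rewrite (PhiU m n n2) alpha_opposite -l2h. Qed.

Let V2E m n : Phi m (n + 1) l2
  = edge_mx (b m n) (v m n) (beta m n l1) (- h / ('i%C * l1)) *m Phi m n l2.
Proof. by rewrite (PhiV m n n2) beta_opposite -il2h. Qed.

Let k := l1 ^+ 2 - l1 ^- 2.

Let k_neq0 : k != 0.
Proof.
rewrite /k unit_circle_sqr_sub // mulf_neq0 ?ii_neq0 // fmorph_eq0.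
by rewrite mulf_neq0 ?pnatr_eq0.
Qed.

Lemma netF_edge1 m n : netF_mx (m + 1) n - netF_mx m n
  = ((u m n / alpha m n l1)%:C * k)
    *: (invmx (Phi m n l1) *m reflection e *m Phi (m + 1) n l2).
Proof.
rewrite /netF_mx Me.
exact: (net_edge_F n1 eh h1 (u0 m n) (uPhi m n n1) (dU m n n1) (PhiU m n n1)
  (U2E m n)).
Qed.

Lemma netF_edge2 m n : netF_mx m (n + 1) - netF_mx m n
  = (- (v m n / beta m n l1)%:C * k)
    *: (invmx (Phi m n l1) *m reflection ('i%C * e) *m Phi m (n + 1) l2).
Proof.
rewrite /netF_mx iMe.
rewrite (net_edge_F in1 ieh ih1 (v0 m n) (uPhi m n n1) (dV m n n1) (PhiV m n n1)
  (V2E m n)); congr (_ *: _).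
by rewrite !exprMn sqr_i mulN1r invrN opprK /k; ring.
Qed.

(** This is the form treated for dual nets, with $\rho = -c/s$, $\tau = -1/s$, $p = u^{-2}$ and $q =
    v^{-2}$. *)
Lemma netN_factors : edge_factors F N
  (fun m n => - (c / s) + - s^-1 * u m n ^- 2)
  (fun m n => - (c / s) - - s^-1 * v m n ^- 2).
Proof.
move=> m n; rewrite edge1_netN edge1_netF edge2_netN edge2_netF -!coordsZ.
split; congr coords; rewrite /netN_mx /netF_mx.
  rewrite Me (net_edge_N n1 eh h1 (u0 m n) (uPhi m n n1) (dU m n n1) (PhiU m n n1)
    (U2E m n) s_neq0); congr (_%:C *: _); field.
  by rewrite s_neq0 u0.
have is0 : complex.Im (('i%C * l1) ^+ 2) != 0 by rewrite Im_il oppr_eq0.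
rewrite iMe (net_edge_N in1 ieh ih1 (v0 m n) (uPhi m n n1) (dV m n n1) (PhiV m n n1)
  (V2E m n) is0); congr (_%:C *: _); rewrite Re_il Im_il; field.
by rewrite s_neq0 v0.
Qed.

Lemma netF_edge_norm m n :
  sqnorm (edge1 F m n) = 4 * u m n ^+ 2 * s ^+ 2 / alpha m n l1 ^+ 2 /\
  sqnorm (edge2 F m n) = 4 * v m n ^+ 2 * s ^+ 2 / beta m n l1 ^+ 2.
Proof.
have qB X Y : quaternionic X -> quaternionic Y -> quaternionic (X - Y).
  by move=> qX qY; apply: quaternionicD => //; apply: quaternionicN.
split; apply: (@complexI R); rewrite ?edge1_netF ?edge2_netF sqnorm_coords;
  try by apply: qB; exact: quaternionic_netF.
  rewrite /netF_mx Me.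
  exact: (det_net_edge_F n1 eh h1 (u0 m n) (uPhi m n n1) (dU m n n1) (PhiU m n n1)
    (U2E m n) (dPhi _ _ n1) (dPhi _ _ n2)).
rewrite /netF_mx iMe (det_net_edge_F in1 ieh ih1 (v0 m n) (uPhi m n n1) (dV m n n1)
  (PhiV m n n1) (V2E m n) (dPhi _ _ n1) (dPhi _ _ n2)).
by rewrite Im_il sqrrN.
Qed.

(** Stripped of the frames and a nonzero factor, the lower right entry of a vanishing combination is
    $z l_2^2 + r = 0$ with real $z$, $r$. Since $l_2^2$ is not real, both vanish: $p u + q v = 0$
    and $p/u - q/v = 0$, which forces $p = q = 0$ as $u^2 + v^2 \neq 0$. *)
Lemma netF_independent m n : independent (edge1 F m n) (edge2 F m n).
Proof.
move=> x y; rewrite edge1_netF edge2_netF -!coordsZ -coordsD => E0.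
have qB X Y : quaternionic X -> quaternionic Y -> quaternionic (X - Y).
  by move=> qX qY; apply: quaternionicD => //; apply: quaternionicN.
have q0 : quaternionic (0 : 'M[C]_2).
  by split; rewrite !mxE; apply: complexP; rewrite /= ?oppr0.
have c0 : coords 0 = 0 :> 'rV[R]_4 by rewrite -(scale0r 0) -[0 in LHS]/(0%:C) coordsZ scale0r.
have qe i j i' j' : quaternionic (netF_mx i j - netF_mx i' j').
  by apply: qB; exact: quaternionic_netF.
rewrite -c0 in E0.
have := coords_inj (quaternionicD (quaternionicZ x (qe _ _ _ _))
  (quaternionicZ y (qe _ _ _ _))) q0 E0.
rewrite netF_edge1 netF_edge2 (PhiU m n n2) (PhiV m n n2) alpha_opposite beta_opposite.
have [al0 be0 _ _] := lax_factors m n n1.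
set U := edge_mx _ _ _ l2; set V := edge_mx _ _ _ ('i%C * l2).
move=> E.
rewrite !scalerA in E.
have {}E := comb_conj_eq0 (uPhi m n n1) (uPhi m n n2) E.
have {}E : (x * u m n / alpha m n l1 ^+ 2 * u m n
            + y * v m n / beta m n l1 ^+ 2 * v m n)%:C * l2 ^+ 2
         + (x * u m n / alpha m n l1 ^+ 2 / u m n
            - y * v m n / beta m n l1 ^+ 2 / v m n)%:C = 0.
  have refl11 (z : C) (X : 'M[C]_2) : (reflection z *m X) 1 1 = z * X 0 1.
    by rewrite {1}(mx2E X) mul_mx2 !mxE /=; ring.
  have U01 : U 0 1 = (alpha m n l1)%:C^-1
      * (- (l2 * (u m n)%:C) - l2^-1 * (u m n)%:C^-1).
    by rewrite /U edge_mxE !mxE /= !fmorphV.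
  have V01 : V 0 1 = 'i%C * ((beta m n l1)%:C^-1
      * (l2^-1 * (v m n)%:C^-1 - l2 * (v m n)%:C)).
    by rewrite /V edge_mxE !mxE /= invfM inv_ii !fmorphV /=; ring.
  have := comb_entry 1 1 E; rewrite !refl11 U01 V01 (mulrACA 'i%C e) mul_ii mulN1r => E11.
  have [alC beC uC vC] : [/\ (alpha m n l1)%:C != 0, (beta m n l1)%:C != 0,
      (u m n)%:C != 0 & (v m n)%:C != 0] by rewrite !fmorph_eq0.
  have l20 : l2 != 0 by exact: expi_neq0.
  apply: (mulfI (mulf_neq0 e0 k_neq0)); rewrite mulr0 -(mulr0 (- l2)) -{}E11.
  rewrite !(rmorphD, rmorphN, rmorphM) /= !fmorphV !rmorphXn /=.
  by field; rewrite alC beC uC vC l20.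
set p := x * u m n / _ in E; set q := y * v m n / _ in E.
have r1 : p * u m n + q * v m n = 0.
  have := congr1 (@complex.Im R) E.
  have := Im_l2; case: (l2 ^+ 2) => zr zi /= -> /eqP.
  by rewrite mul0r !addr0 mulf_eq0 oppr_eq0 (negPf s_neq0) orbF => /eqP.
have r2 : p / u m n - q / v m n = 0.
  by move: E; rewrite r1 mul0r add0r => /complexI.
have p0 : p = 0.
  have d0 : u m n ^+ 2 + v m n ^+ 2 != 0.
    by rewrite gt_eqF // addr_gt0 // exprn_even_gt0 ?u0 ?v0.
  apply: (mulIf d0); rewrite mul0r.
  transitivity (u m n * (p * u m n + q * v m n)
    + u m n * v m n ^+ 2 * (p / u m n - q / v m n)); last first.
    by rewrite r1 r2 !mulr0 addr0.
  by field; rewrite u0 v0.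
have q_eq0 : q = 0.
  by move: r1; rewrite p0 mul0r add0r => /eqP; rewrite mulf_eq0 (negPf (v0 m n)) orbF => /eqP.
move/eqP: p0; move/eqP: q_eq0; rewrite /p /q !mulf_eq0 !invr_eq0 !expf_eq0 /=.
by rewrite (negPf al0) (negPf be0) (negPf (u0 m n)) (negPf (v0 m n)) !orbF => /eqP -> /eqP.
Qed.

Lemma reflection_word : (reflection e *m reflection ('i%C * e))
  *m (reflection e *m reflection ('i%C * e)) = - 1%:M.
Proof.
have -> : reflection e *m reflection ('i%C * e) = mx2 'i%C 0 0 (- 'i%C).
  by rewrite /reflection mul_mx2 (invfM 'i%C e) inv_ii; congr mx2; field.
rewrite mul_mx2 scalar_mx2 opp_mx2.
by congr mx2; rewrite ?mulr0 ?mul0r ?mulrNN ?mul_ii ?addr0 ?add0r ?oppr0.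
Qed.

(** Since [alpha] and [beta] agree on opposite edges, the edge scalars leave $-\beta^2/\alpha^2$
    times $u u' / (v v')$, and the last quotient is 1 by [lax_uv]. *)
Lemma netF_cross_ratio m n : cross_ratio F m n
  = (- (beta m n l1 ^+ 2 / alpha m n l1 ^+ 2))%:C%:M.
Proof.
rewrite (@cross_ratio_quat R F netF_mx m n (fun i j => quaternionic_coordsK (quaternionic_netF i j))).
have alE : alpha m (n + 1) l1 = alpha m n l1 by rewrite (lax_alpha hlax).
have beE : beta (m + 1) n l1 = beta m n l1 by rewrite (lax_beta hlax).
have [al0 be0 _ _] := lax_factors m n n1.
have kv i j x : x != 0 -> - (v i j / x)%:C * k != 0.
  by move=> x0; rewrite mulf_neq0 // oppr_eq0 fmorph_eq0 mulf_neq0 ?invr_eq0.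
have be'0 : beta (m + 1) n l1 != 0 by rewrite beE.
have il10 : 'i%C * l1 != 0 by rewrite mulf_neq0 ?ii_neq0.
have cp := lax_compat hlax m n n1; rewrite !Vmx_edge_mx !Umx_edge_mx in cp.
have TU := edge_mx_reflection l10 eh h1 (a m (n + 1)) (alpha m (n + 1) l1)
  (u0 m (n + 1)); rewrite (dU m (n + 1) n1) in TU.
have TV := edge_mx_reflection il10 ieh ih1 (b (m + 1) n) (beta (m + 1) n l1)
  (v0 (m + 1) n); rewrite (dV (m + 1) n n1) in TV.
rewrite (cross_ratio_edges (uPhi m n n1) (det1_unit (dV m n n1)) (uPhi (m + 1) n n1)
  (uPhi (m + 1) n n2) (uPhi m (n + 1) n2) (uPhi (m + 1) (n + 1) n2)
  (PhiU m n n1) (PhiV m n n1) (V2E (m + 1) n) (U2E m (n + 1)) cp TU TV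
  (reflectionK eh h1) (reflectionK ieh ih1) reflection_word
  (kv m n _ be0) (kv (m + 1) n _ be'0)
  (netF_edge1 m n) (netF_edge1 m (n + 1)) (netF_edge2 m n) (netF_edge2 (m + 1) n)).
congr (_%:M); rewrite alE beE.
have [alC beC] : (alpha m n l1)%:C != 0 /\ (beta m n l1)%:C != 0.
  by rewrite !fmorph_eq0.
have vC i j : (v i j)%:C != 0 by rewrite fmorph_eq0.
have uv := congr1 (real_complex R) (lax_uv m n); rewrite !rmorphM /= in uv.
rewrite !(rmorphN, rmorphM) /= !fmorphV !rmorphXn /=.
transitivity (- ((u m n)%:C * (u m (n + 1))%:C / ((v m n)%:C * (v (m + 1) n)%:C)
    * ((beta m n l1)%:C ^+ 2 / (alpha m n l1)%:C ^+ 2))).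
  by field; rewrite !vC alC beC k_neq0.
by rewrite uv mulfV ?mul1r // mulf_neq0.
Qed.

End Opposite.

(** * Necessity of opposite spectral parameters *)

Lemma area_constant (G : int -> int -> 'rV[R]_4) (z : 'rV[R]_4) e1 e2 m n :
  (forall m n, G m n = z) -> area e1 e2 G m n = 0.
Proof. by move=> Gz; rewrite area_diagonal /wedge /face_diagonal !Gz !dotE; ring. Qed.

(** Here $w^2 = \pm 1$. If $w^2 = 1$, then [M] is scalar and the frames cancel. If $w^2 = -1$, then
    $l_2 = -l_1$ and [M] is a multiple of [sigma3], which the twist of the frame moves to the
    right. *)
Lemma netF_mx_constant : l2 ^+ 2 = l1 ^+ 2 -> exists X, forall m n, netF_mx m n = X.
Proof.
have E m n x : w ^+ 2 = x -> x = 1 -> netF_mx m n = w%:M.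
  move=> w2 x1; rewrite /netF_mx ME.
  have -> : w^-1 = w by apply: (mulfI w0); rewrite mulfV // -expr2 w2.
  by rewrite -scalar_mx2 l2E w2 x1 mulr1 mul_mx_scalar -scalemxAl mulVmx ?uPhi // scalemx1.
move/eqP; rewrite eqf_sqr l2E -subr_eq0 -[X in _ || X]subr_eq0.
rewrite opprK -{2 4}[l1]mulr1 -mulrBr -mulrDr !mulf_eq0 (negPf l10) /=.
rewrite subr_eq0 addr_eq0 => /orP[] /eqP w2.
  by exists w%:M => m n; apply: E w2 _.
exists (w *: sigma3 R) => m n; rewrite /netF_mx ME.
have -> : w^-1 = - w by apply: (mulfI w0); rewrite mulfV // mulrN -expr2 w2 opprK.
have -> : l2 = - l1 by rewrite l2E w2 mulrN1.
have -> : mx2 w 0 0 (- w) = w *: sigma3 R.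
  by rewrite scale_mx2 mulr1 !mulr0 mulrN1.
have ss : sigma3 R *m sigma3 R = 1%:M.
  by rewrite mul_mx2 scalar_mx2; congr mx2; ring.
rewrite (frame_twisted hframe) // -scalemxAr -!scalemxAl; congr (_ *: _).
by rewrite -!mulmxA (mulmxA (sigma3 R) (sigma3 R)) ss mul1mx mulmxA mulVmx ?uPhi // mul1mx.
Qed.

(* The two diagonals of the gauged difference differ by the factor [i], so
   that parallel edges force it to vanish. *)
Lemma parallel_edge_factor (a0 l l' : C) (u' al al' : R) (A1 A2 B1 B2 : 'M[C]_2) :
  A1 \in unitmx -> A2 \in unitmx -> a0 != 0 ->
  edge_mx a0 u' al l \in unitmx ->
  B1 = edge_mx a0 u' al l *m A1 -> B2 = edge_mx a0 u' al' l' *m A2 ->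
  let X := invmx B1 *m M *m B2 - invmx A1 *m M *m A2 in
  let Y := - (invmx B1 *m qk R *m M *m B2) - - (invmx A1 *m qk R *m M *m A2) in
  (exists r : R, Y = r%:C *: X \/ X = r%:C *: Y) -> al^-1 = al'^-1.
Proof.
move=> uA1 uA2 a00 uZ B1E B2E X Y.
set Z := edge_mx a0 u' al l in uZ B1E; set Z' := edge_mx a0 u' al' l' in B2E.
pose x := M *m Z' - Z *m M; pose y := - (qk R *m M *m Z' - Z *m (qk R *m M)).
have XE : X = (invmx A1 *m invmx Z) *m x *m A2.
  by rewrite /X B1E B2E (net_edge _ _ _ uA1 uZ).
have YE : Y = (invmx A1 *m invmx Z) *m y *m A2.
  by rewrite /Y B1E B2E (net_edge_normal _ _ _ _ uA1 uZ).
have uAZ : invmx A1 *m invmx Z \in unitmx by rewrite unitmx_mul !unitmx_inv uA1.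
have x00 : x 0 0 = w * a0 * (al'^-1 - al^-1)%:C.
  by rewrite /x ME /Z /Z' !edge_mxE !mx2_simp !mxE /= rmorphB /=; ring.
have y00 : y 0 0 = 'i%C * x 0 0.
  by rewrite x00 /y ME qkE /Z /Z' !edge_mxE !mx2_simp !mxE /= rmorphB /=; ring.
have ir (r : R) : 'i%C != r%:C :> C.
  by rewrite eq_complex /= oner_eq0 andbF.
move=> [r xy]; have {xy} : y = r%:C *: x \/ x = r%:C *: y.
  by case: xy; rewrite XE YE => /(conj_scale_inj uAZ uA2); [left|right].
have x0 : (exists r, y = r%:C *: x \/ x = r%:C *: y) -> x 0 0 = 0.
  move=> [r' [] /(scale_entry 0 0)]; rewrite y00 => /eqP.
    by rewrite -subr_eq0 -mulrBl mulf_eq0 subr_eq0 (negPf (ir _)) => /eqP.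
  rewrite -{1}[x 0 0]mul1r -subr_eq0 mulrA -mulrBl mulf_eq0 => /orP[|/eqP//].
  rewrite subr_eq0 => /eqP /(congr1 ( *%R^~ 'i%C)).
  rewrite mul1r -mulrA mul_ii mulrN1 -rmorphN => /eqP.
  by rewrite (negPf (ir _)).
move=> xy; have := x0 (ex_intro _ r xy); rewrite x00 => /eqP.
rewrite !mulf_eq0 (negPf w0) (negPf a00) /= fmorph_eq0 subr_eq0 => /eqP.
by move=> ->.
Qed.

Lemma cmc_opposite H : (exists m n, a m n != 0 \/ b m n != 0) -> cmc F N H ->
  (l2 = l1^-1 \/ l2 = - l1^-1) /\ s != 0.
Proof.
move=> [m [n ab0]] hcmc.
have qB X Y : quaternionic X -> quaternionic Y -> quaternionic (X - Y).
  by move=> qX qY; apply: quaternionicD => //; apply: quaternionicN.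
have par X Y : quaternionic X -> quaternionic Y ->
    Defs.parallel (coords X) (coords Y) ->
    exists r : R, Y = r%:C *: X \/ X = r%:C *: Y.
  move=> qX qY [r rXY]; exists r; case: rXY; rewrite -coordsZ => /coords_inj E.
    by left; apply: E => //; apply: quaternionicZ.
  by right; apply: E => //; apply: quaternionicZ.
(* A constant [F] has faces of area 0, which [face_mean_curvature] excludes. *)
have Fsq : l2 ^+ 2 <> l1 ^+ 2.
  move=> /netF_mx_constant[X FX].
  have [e1 [e2 [_ _ _ + _]]] := cmc_curvature hcmc m n.
  by rewrite (@area_constant F (coords X)) ?eqxx // => k l; rewrite -(FX k l).
have Re12 : complex.Re (l1 ^+ 2) = complex.Re (l2 ^+ 2).
  have [_ _ al1 be1] := lax_factors m n n1; have [_ _ al2 be2] := lax_factors m n n2.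
  have qF i j i' j' : quaternionic (netF_mx i j - netF_mx i' j').
    by apply: qB; exact: quaternionic_netF.
  have qN i j i' j' : quaternionic (netN_mx i j - netN_mx i' j').
    by apply: qB; exact: quaternionic_netN.
  have two0 : 2 != 0 :> R by rewrite pnatr_eq0.
  have [p1 p2] := cmc_parallel hcmc m n.
  rewrite -/(edge1 F m n) -/(edge1 N m n) edge1_netF edge1_netN in p1.
  rewrite -/(edge2 F m n) -/(edge2 N m n) edge2_netF edge2_netN in p2.
  case: ab0 => [a0|b0].
    have /invr_inj E : (alpha m n l1)^-1 = (alpha m n l2)^-1.
      exact: (parallel_edge_factor (uPhi m n n1) (uPhi m n n2) a0
        (det1_unit (dU m n n1)) (PhiU m n n1) (PhiU m n n2)
        (par _ _ (qF _ _ _ _) (qN _ _ _ _) p1)).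
    by move: al1; rewrite E al2 => /addrI /(mulfI two0).
  have /invr_inj E : (beta m n l1)^-1 = (beta m n l2)^-1.
    exact: (parallel_edge_factor (uPhi m n n1) (uPhi m n n2) b0
      (det1_unit (dV m n n1)) (PhiV m n n1) (PhiV m n n2)
      (par _ _ (qF _ _ _ _) (qN _ _ _ _) p2)).
  by move: be1; rewrite E be2 => /addrI /oppr_inj /(mulfI two0).
have l20 : l2 != 0 by exact: expi_neq0.
(* Equal real parts mean that $l^2 + l^{-2}$ agrees at both parameters; the difference factors as
   $(l_1^2 - l_2^2)(1 - (l_1 l_2)^{-2})$. *)
have ll : (l1 * l2) ^+ 2 = 1.
  have := unit_circle_sqr_add n1; rewrite Re12 -unit_circle_sqr_add // => E.
  have /eqP : (l1 ^+ 2 - l2 ^+ 2) * (1 - (l1 * l2) ^- 2) = 0.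
    transitivity (l1 ^+ 2 + l1 ^- 2 - (l2 ^+ 2 + l2 ^- 2)); last by rewrite E subrr.
    by field; rewrite l10 l20.
  rewrite mulf_eq0 subr_eq0 => /orP[/eqP h|]; first by case: Fsq.
  by rewrite subr_eq0 eq_sym invr_eq1 => /eqP.
have opp : l2 = l1^-1 \/ l2 = - l1^-1.
  move/eqP: ll; rewrite sqrf_eq1 => /orP[] /eqP E; [left|right];
    by apply: (mulfI l10); rewrite E ?mulrN mulfV.
split=> //; apply/eqP => s0; case: Fsq.
(* If $l_1^2$ were real, it would equal its inverse, which is $l_2^2$. *)
have l1sq : l1 ^+ 2 = l1 ^- 2.
  apply/eqP; rewrite -subr_eq0 unit_circle_sqr_sub // s0 mulr0.
  by rewrite mul0r.
by rewrite l1sq; case: opp => ->; rewrite ?sqrrN exprVn.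
Qed.

End FrameNets.

(** * Angles and the trigonometric form of the curvature *)

Section Curvature.
Variable R : realType.

(** Both sides say that $e^{i(\gamma_1+\gamma_2)}$ is real, that is, $1$ or $-1$. *)
Lemma opposite_angles (g1 g2 : R) :
  (expi g2 = (expi g1)^-1 \/ expi g2 = - (expi g1)^-1) <->
  exists k : int, g1 + g2 = k%:~R * pi.
Proof.
have l0 := expi_neq0 g1; split=> [opp|[k gk]].
  apply: sin_eq0; have : expi (g1 + g2) = 1 \/ expi (g1 + g2) = -1 :> R[i].
    by rewrite expiD; case: opp => ->; rewrite ?mulrN mulfV //; [left|right].
  by case=> -[_ ->]; rewrite ?oppr0.
have sg : sin (g1 + g2) = 0 by rewrite gk sin_intpi.
have := cos2Dsin2 (g1 + g2); rewrite sg expr0n addr0 => /eqP.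
rewrite sqrf_eq1 => /orP[] /eqP cg; [left|right]; apply: (mulfI l0);
  rewrite ?mulrN mulfV // -expiD; apply: complexP; by rewrite /= ?cg ?sg ?oppr0.
Qed.

(** The numbers $e^{i(\gamma_1-\gamma_2)}$ and $e^{2i\gamma_1}$ agree up to sign, which the
    cotangent does not see. *)
Lemma cot_opposite (g1 g2 : R) :
  expi g2 = (expi g1)^-1 \/ expi g2 = - (expi g1)^-1 ->
  cot (g1 - g2) = cot (2 * g1).
Proof.
move=> opp; have l0 := expi_neq0 g1.
have : expi (g1 - g2) = expi (2 * g1) \/ expi (g1 - g2) = - expi (2 * g1).
  rewrite expiD expiN -expi_sqr expr2.
  by case: opp => ->; rewrite ?invrN invrK ?mulrN; [left|right].
by rewrite /cot; case=> -[-> ->]; rewrite ?invrN ?mulrNN.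
Qed.

Variables c s : R.
Hypothesis cs : c ^+ 2 + s ^+ 2 = 1.
Hypothesis s_neq0 : s != 0.

Let HE : 1 + (c / s) ^+ 2 = s^-1 ^+ 2.
Proof.
have -> : 1 + (c / s) ^+ 2 = (c ^+ 2 + s ^+ 2) / s ^+ 2 by field.
by rewrite cs mul1r exprVn.
Qed.

Lemma curvature_sqrt : Num.sqrt (1 + (c / s) ^+ 2) = `|s|^-1.
Proof. by rewrite HE sqrtr_sqr normfV. Qed.

Lemma curvature_ratio : Num.sqrt ((c / s) ^+ 2 / (1 + (c / s) ^+ 2)) = `|c|.
Proof.
rewrite HE (_ : _ / _ = c ^+ 2) ?sqrtr_sqr //.
by field.
Qed.

(** With $H = c/s$, $|H| \sqrt{1+H^2} = |c|/s^2$, so $|c|$ cancels. *)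
Lemma curvature_length x y : c != 0 ->
  4 * (x * `|c|) / (y * `|c / s| * `|s|^-1) = 4 * x * s ^+ 2 / y.
Proof.
move=> c0; rewrite normrM normfV.
have -> : s ^+ 2 = `|s| ^+ 2 by rewrite real_normK // num_real.
have [-> | y0] := eqVneq y 0; first by rewrite !mul0r invr0 !mulr0.
by field; rewrite y0 !normr_eq0 c0 s_neq0.
Qed.

End Curvature.

(** * Curvature, duals, metric and edge lengths of the pair *)

Theorem theorem5 (R : realType)
  (a b : int -> int -> R[i]) (u v : int -> int -> R)
  (alpha beta : int -> int -> R[i] -> R)
  (Phi : int -> int -> R[i] -> 'M[R[i]]_2) (g1 g2 : R)
  (hlax : lax_pair a b u v alpha beta)
  (hframe : frame a b u v alpha beta Phi) :
  let l1 := expi g1 in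
  let l2 := expi g2 in
  let F := netF Phi g1 g2 in
  let N := netN Phi g1 g2 in
  let H := complex.Re (l1 ^+ 2) / complex.Im (l1 ^+ 2) in
  let K := Num.sqrt (H ^+ 2 / (1 + H ^+ 2)) in
  let sg := Num.sg (complex.Re (l1 ^+ 2)) in
  let opposite := l2 = l1^-1 \/ l2 = - l1^-1 in
  (opposite <-> exists k : int, g1 + g2 = k%:~R * pi) /\
  ((exists m n, a m n != 0 \/ b m n != 0) ->
     (isothermic_cmc F N <-> opposite /\ complex.Im (l1 ^+ 2) != 0)) /\
  (opposite -> complex.Im (l1 ^+ 2) != 0 ->
    isothermic_cmc F N /\
    (cmc F N H /\ H = cot (2 * g1) /\ H = cot (g1 - g2)) /\
    (H != 0 -> christoffel_dual F (fun m n => F m n + H^-1 *: N m n)) /\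
    (H = 0 -> christoffel_dual F N) /\
    (forall m n,
       cross_ratio F m n = (- (beta m n l1 ^+ 2 / alpha m n l1 ^+ 2))%:C%:M) /\
    exists s : int -> int -> R,
      conformal_metric F s /\
      (forall t, conformal_metric F t -> black_white_rescaling s t) /\
      (H != 0 -> forall m n,
        let ss1 := s m n * s (m + 1) n in
        let ss2 := s m n * s m (n + 1) in
        let A := alpha m n l1 in
        let B := beta m n l1 in
        let E1 := sqnorm (F (m + 1) n - F m n) in
        let E2 := sqnorm (F m (n + 1) - F m n) in
        [/\ ss1 = - (u m n ^+ 2) * K,
            ss2 = v m n ^+ 2 * K,
            [/\ E1 = 4 * u m n ^+ 2 * sin (2 * g1) ^+ 2 / A ^+ 2,
                E1 = 4 * `|ss1| / (A ^+ 2 * `|H| * Num.sqrt (1 + H ^+ 2)) &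
                E1 = 4 * `|ss1| /
                  ((ComplexField.Normc.normc (a m n) ^+ 2 + u m n ^+ 2 + u m n ^- 2 + 2 * sg * K)
                     * `|H| * Num.sqrt (1 + H ^+ 2))] &
            [/\ E2 = 4 * v m n ^+ 2 * sin (2 * g1) ^+ 2 / B ^+ 2,
                E2 = 4 * `|ss2| / (B ^+ 2 * `|H| * Num.sqrt (1 + H ^+ 2)) &
                E2 = 4 * `|ss2| /
                  ((ComplexField.Normc.normc (b m n) ^+ 2 + v m n ^+ 2 + v m n ^- 2 - 2 * sg * K)
                     * `|H| * Num.sqrt (1 + H ^+ 2))]]) /\
      (H = 0 -> forall m n,
        let ss1 := s m n * s (m + 1) n in
        let ss2 := s m n * s m (n + 1) in
        let A := alpha m n l1 in
        let B := beta m n l1 in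
        let E1 := sqnorm (F (m + 1) n - F m n) in
        let E2 := sqnorm (F m (n + 1) - F m n) in
        [/\ ss1 = - (u m n ^+ 2),
            ss2 = v m n ^+ 2,
            E1 = 4 * u m n ^+ 2 / A ^+ 2 /\
            E1 = - (4 * ss1 / (ComplexField.Normc.normc (a m n) ^+ 2 - ss1 - ss1^-1)) &
            E2 = 4 * v m n ^+ 2 / B ^+ 2 /\
            E2 = 4 * ss2 / (ComplexField.Normc.normc (b m n) ^+ 2 + ss2 + ss2^-1)])).
Proof.
move=> l1 l2 F N; set c := complex.Re (l1 ^+ 2); set s := complex.Im (l1 ^+ 2).
move=> H K sg opposite.
have cE : c = cos (2 * g1) by rewrite /c /l1 expi_sqr.
have sE : s = sin (2 * g1) by rewrite /s /l1 expi_sqr.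
have cs : c ^+ 2 + s ^+ 2 = 1 by rewrite cE sE cos2Dsin2.
have main : opposite -> s != 0 -> edge_factors F N
    (fun m n => - H + - s^-1 * u m n ^- 2) (fun m n => - H - - s^-1 * v m n ^- 2).
  by move=> opp s0; exact: (netN_factors hlax hframe opp s0).
have p_gt0 m n : 0 < u m n ^- 2.
  by rewrite invr_gt0 exprn_gt0 // (lax_u_gt0 hlax).
have q_gt0 m n : 0 < v m n ^- 2.
  by rewrite invr_gt0 exprn_gt0 // (lax_v_gt0 hlax).
have pq m n : u m n ^- 2 * u m (n + 1) ^- 2 = v m n ^- 2 * v (m + 1) n ^- 2.
  by rewrite -!invfM -!exprMn (lax_uv hlax).
have tau0 : s != 0 -> - s^-1 != 0 by rewrite oppr_eq0 invr_eq0.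
have indep : opposite -> s != 0 ->
    forall m n, independent (edge1 F m n) (edge2 F m n).
  by move=> opp s0 m n; exact: (netF_independent hlax hframe opp s0).
have cmcF : opposite -> s != 0 -> cmc F N H.
  move=> opp s0; rewrite -[H]opprK.
  apply: (cmc_factors p_gt0 q_gt0 pq (tau0 s0) (main opp s0) (indep opp s0)).
    by move=> m n; split; [exact: (netF_sphere g1 g2 hframe)|exact: (netN_sphere g1 g2 hframe)].
  by move=> m n; exact: (netF_netN_orthogonal g1 g2 hframe).
(* Adding [H *: F] removes the constant part [- H] of the edge factors. The choices $k = H^{-1}$ and
   $k = 1$ give the duals for $H \neq 0$ and $H = 0$. *)
have dualF : opposite -> s != 0 -> forall k, k != 0 ->
    christoffel_dual F (fun m n => k *: (N m n + H *: F m n)).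
  move=> opp s0 k k0.
  have ks0 : k * s^-1 != 0 by rewrite mulf_neq0 ?invr_eq0.
  apply: (christoffel_dual_factors p_gt0 q_gt0 pq (tau0 s0) (main opp s0)
    (indep opp s0) ks0).
  have h := edge_factors_comb H k (main opp s0).
  by move=> m n; have [-> ->] := h m n; split; congr (_ *: _); ring.
have isoF : opposite -> s != 0 -> isothermic_cmc F N.
  move=> opp s0; split; last by exists H; apply: cmcF.
  split; last first.
    by exists (fun m n => 1 *: (N m n + H *: F m n)); apply: dualF; rewrite ?oner_eq0.
  apply: spherical_circular_faces.
  - by move=> m n; exact: (netF_sphere g1 g2 hframe).
  - by have [] := planar_faces_pair p_gt0 q_gt0 (tau0 s0) (main opp s0) (indep opp s0).
  - by move=> m n; have [] := independent_neq0 (indep opp s0 m n).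
split; first exact: opposite_angles.
split.
  move=> ab0; split; last by case; exact: isoF.
  by case=> _ [H' hcmc]; exact: (cmc_opposite hlax hframe ab0 hcmc).
move=> opp s0; split; first exact: isoF.
split.
  split; first exact: cmcF.
  by split; rewrite ?cot_opposite // /cot -cE -sE.
split.
  move=> H0; have := dualF opp s0 H^-1; rewrite invr_eq0 => /(_ H0).
  congr christoffel_dual; apply/funext => m; apply/funext => n.
  by rewrite scalerDr scalerA mulVf // scale1r addrC.
split.
  move=> H0; have := dualF opp s0 1 (oner_neq0 _).
  congr christoffel_dual; apply/funext => m; apply/funext => n.
  by rewrite scale1r H0 scale0r addr0.
split; first by move=> m n; exact: (netF_cross_ratio hlax hframe opp s0).
have KE : K = `|c| by exact: curvature_ratio.
(* [K] vanishes for minimal nets, where the scale of the metric is 1 instead. *)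
pose K0 := if H == 0 then 1 else K.
have H0E : (H == 0) = (c == 0) by rewrite mulf_eq0 invr_eq0 (negPf s0) orbF.
have K00 : K0 != 0.
  by rewrite /K0; case: ifPn; rewrite ?oner_eq0 // KE normr_eq0 H0E.
have [t ht tE] := conformal_metric_exists p_gt0 q_gt0 pq (tau0 s0) (main opp s0)
  (indep opp s0) K00.
exists t; split=> //; split.
  by move=> t' ht'; exact: (conformal_metric_unique p_gt0 q_gt0 pq (tau0 s0)
    (main opp s0) (indep opp s0) ht ht').
have tE1 m n : t m n * t (m + 1) n = - (u m n ^+ 2) * K0.
  by have [-> _] := tE m n; rewrite invrK mulrC mulNr.
have tE2 m n : t m n * t m (n + 1) = v m n ^+ 2 * K0.
  by have [_ ->] := tE m n; rewrite invrK mulrC.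
have norms m n := netF_edge_norm hlax hframe opp m n.
have factors m n := lax_factors hlax m n (norm_expi g1).
split=> H0 m n ss1 ss2 A B E1 E2.
  have K0K : K0 = K by rewrite /K0 (negPf H0).
  have c0 : c != 0 by rewrite -H0E.
  (* [K] is only the modulus of [c]; the sign restores the term $2c$ in $\alpha^2$ and $\beta^2$. *)
  have sgK : 2 * sg * K = 2 * c by rewrite KE -mulrA -numEsg.
  have [n1 n2] := norms m n; have [_ _ A2 B2] := factors m n.
  rewrite -sE sgK -A2 -B2 curvature_sqrt //.
  have ss1E : `|ss1| = u m n ^+ 2 * `|c|.
    by rewrite /ss1 tE1 K0K KE normrM normrN normr_id ger0_norm ?sqr_ge0.
  have ss2E : `|ss2| = v m n ^+ 2 * `|c|.
    by rewrite /ss2 tE2 K0K KE normrM normr_id ger0_norm ?sqr_ge0.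
  by rewrite ss1E ss2E !curvature_length // -K0K -tE1 -tE2.
have K01 : K0 = 1 by rewrite /K0 H0 eqxx.
(* For a minimal net $l_1^2 = \pm i$: then $s^2 = 1$, and the spectral terms of $\alpha^2$ and
   $\beta^2$ drop out. *)
have c0 : c = 0 by apply/eqP; rewrite -H0E H0.
have s2 : s ^+ 2 = 1 by move: cs; rewrite c0 expr0n add0r.
have [n1 n2] := norms m n; have [_ _ A2 B2] := factors m n.
rewrite -/c c0 mulr0 ?addr0 ?subr0 in A2 B2.
rewrite -/s s2 !mulr1 in n1 n2.
have E1E : E1 = 4 * u m n ^+ 2 / A ^+ 2 by exact: n1.
have E2E : E2 = 4 * v m n ^+ 2 / B ^+ 2 by exact: n2.
rewrite /ss1 /ss2 tE1 tE2 K01 !mulr1; split=> //; split=> //.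
  by rewrite E1E A2 invrN !opprK mulrN mulNr opprK.
by rewrite E2E B2.
Qed.
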